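(* Let $E$, $A\subset\mathbb{K}^{\mathbb{N}}$ and $X$ be Fréchet spaces over $\mathbb{K}=\mathbb{R}$ or $\mathbb{C}$, with topologies given by translation-invariant metrics $d_E$, $d_A$, $\varrho$ respectively, let $\mathcal{F}=(f_k)_{k\geq 0}\subset E$, $\mathcal{X}=(x_{n,k})_{n\geq k\geq 0}\subset X$ and $T_0:E\to A$ satisfy the standing assumptions (i)–(v) listed in the context. Let $\mu=(\mu_n)_n\subset\mathbb{N}$ be an increasing sequence. (A) For generalized universal series: (A)-(1) The following assertions are equivalent: (i) $\mathcal{U}^{\mu}(\mathcal{X})\cap E\neq\emptyset$; (ii) for every $x\in X$ and every $\varepsilon>0$, there exist $n\geq 0$ and $f\in E$ such that $\varrho(S_{\mu_n}^{\mathcal{X}}\circ T_0(f),x)<\varepsilon$ and $d_E(f,0)<\varepsilon$; (iii) $\mathcal{U}^{\mu}(\mathcal{X})\cap E$ is a dense $G_\delta$ subset of $E$. (A)-(2) If, for every increasing sequence $\nu=(\nu_n)_n\subset\mu$, $\mathcal{U}^{\nu}(\mathcal{X})\cap E$ is non-empty, then $\mathcal{U}^{\mu}(\mathcal{X})\cap E$ contains, apart from $0$, a dense subspace of $E$. (A)-(3) If $E$ admits a continuous norm and if, for every increasing sequence $\nu=(\nu_n)_n\subset\mu$, $\mathcal{U}^{\nu}(\mathcal{X})\cap E$ is non-empty, then $\mathcal{U}^{\mu}(\mathcal{X})\cap E$ is spaceable. (B) For restricted generalized universal series: (B)-(1) The following assertions are equivalent: (i) $\mathcal{U}^{\mu}_E(\mathcal{X})\neq\emptyset$;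 (ii) for every $x\in X$ and every $\varepsilon>0$, there exist $n\geq 0$ and $f\in E$ such that $\varrho(S_{\mu_n}^{\mathcal{X}}\circ T_0(f),x)<\varepsilon$ and $d_E(S_{\mu_n}^{\mathcal{F}}\circ T_0(f),0)<\varepsilon$; (iii) $\mathcal{U}^{\mu}_E(\mathcal{X})$ is a dense $G_\delta$ subset of $E$. (B)-(2) If, for every increasing sequence $\nu=(\nu_n)_n\subset\mu$, $\mathcal{U}^{\nu}_E(\mathcal{X})$ is non-empty, then $\mathcal{U}^{\mu}_E(\mathcal{X})$ contains, apart from $0$, a dense subspace of $E$. (B)-(3) If $E$ admits a continuous norm and if, for every increasing sequence $\nu=(\nu_n)_n\subset\mu$, $\mathcal{U}^{\nu}_E(\mathcal{X})$ is non-empty, then $\mathcal{U}^{\mu}_E(\mathcal{X})$ is spaceable.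
   Context: $\mathbb{N}=\{0,1,2,\dots\}$ and ''increasing'' for index sequences means strictly increasing; $\nu\subset\mu$ means that $\nu$ is a subsequence of $\mu$. $(e_k)_{k\geq 0}$ is the canonical sequence of $\mathbb{K}^{\mathbb{N}}$; ''polynomials'' in $\mathbb{K}^{\mathbb{N}}$ are finite linear combinations of the $e_k$'s. Standing assumptions: (i) the set $G\subset\mathbb{K}^{\mathbb{N}}$ of all polynomials is included in $A$ and dense in $A$; (ii) the coordinate projections $A\to\mathbb{K}$, $(a_n)_n\mapsto a_k$, $k\geq 0$, are continuous; (iii) the set $G_E\subset E$ of finite linear combinations of the $f_k$'s is dense in $E$; (iv) $T_0:E\to A$ is a continuous linear map with $T_0(f_k)=e_k$ for every $k\geq 0$; (v) for every $k\geq 0$ the sequence $(x_{n,k})_{n\geq k}$ is convergent in $X$. For $a=(a_k)_k\in A$: $S_n^{\mathcal{F}}(a)=\sum_{k=0}^n a_k f_k\in E$ and $S_n^{\mathcal{X}}(a)=\sum_{k=0}^n a_k x_{n,k}\in X$. $\mathcal{U}^{\mu}(\mathcal{X})\cap E$ is the set of $f\in E$ such that $X=\overline{\{S_{\mu_n}^{\mathcal{X}}\circ T_0(f):\ n\geq 0\}}$ ($\mu$-generalized universal series). $\mathcal{U}^{\mu}_E(\mathcal{X})$ is the set of $f\in E$ such that $X\times\{0\}\subset\overline{\{(S_{\mu_n}^{\mathcal{X}}\circ T_0(f),\,f-S_{\mu_n}^{\mathcal{F}}\circ T_0(f)):\ n\geq 0\}}$, the closure being taken in $X\times E$ ($\mu$-restricted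 generalized universal series). A subset of $E$ contains a subspace ''apart from $0$'' if it contains all non-zero elements of that subspace. A subset of $E$ is spaceable if it contains, apart from $0$, a closed infinite-dimensional subspace of $E$. *)

(* Defs.v *)
From HB Require Import structures.
From mathcomp Require Import all_boot all_order all_algebra.
From mathcomp Require Import all_classical all_reals all_analysis.
From mathcomp Require Import complex.

Set Implicit Arguments.
Unset Strict Implicit.
Unset Printing Implicit Defensive.

Import Order.TTheory GRing.Theory Num.Theory.
Import numFieldNormedType.Exports.

Local Open Scope classical_set_scope.
Local Open Scope ring_scope.
Local Open Scope complex_scope.

Variant real_or_complex (R : realType) : numFieldType -> Prop :=
| ScalarsReal : real_or_complex R R
| ScalarsComplex : real_or_complex R R[i].

(* E is a Frechet space whose topology is given by the translation-invariant
   metric d; local convexity is part of [tvsType]. *)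
Record frechet_metric (R : realType) (K : numFieldType) (E : tvsType K)
    (d : E -> E -> R) : Prop := FrechetMetric {
  frechet_dist_eq0 : forall x y, d x y = 0 <-> x = y;
  frechet_dist_sym : forall x y, d x y = d y x;
  frechet_dist_triangle : forall x y z, d x z <= d x y + d y z;
  frechet_dist_translation : forall x y z, d (x + z) (y + z) = d x y;
  frechet_nbhs : forall x : E,
    nbhs x = filter_from [set e : R | 0 < e] (fun e => [set y | d x y < e]);
  frechet_complete : forall u : nat -> E,
    (forall e : R, 0 < e -> exists N : nat, forall m n : nat,
       (N <= m)%N -> (N <= n)%N -> d (u m) (u n) < e) ->
    exists l : E, u n @[n --> \oo] --> l
}.

(* Locally convex spaces whose elements are the sequences satisfying P, with
   the linear operations of K^nat; the topology need not be the induced one. *)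
#[short(type="tvsSeqType")]
HB.structure Definition TvsSeq (K : numFieldType) (P : {pred (nat -> K^o)}) :=
  {A of Tvs K A & @GRing.SubLmodule K (nat -> K^o) P A}.

Section LinearNotions.
Context {K : numFieldType} {V : lmodType K}.

Definition lin_span (S : set V) : set V :=
  [set v | exists (n : nat) (c : 'I_n -> K) (u : 'I_n -> V),
    (forall i, S (u i)) /\ v = \sum_(i < n) c i *: u i].

Definition infinite_dimensional (M : set V) : Prop :=
  ~ exists2 B : set V, finite_set B & M = lin_span B.

End LinearNotions.

Section SubspaceNotions.
Context {K : numFieldType} {E : tvsType K}.

Definition has_dense_subspace (U : set E) : Prop :=
  exists M : set E,
    [/\ GRing.submod_closed [in M], dense M & M `\ 0 `<=` U].

Definition spaceable (U : set E) : Prop :=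
  exists M : set E, [/\ GRing.submod_closed [in M], closed M,
    infinite_dimensional M & M `\ 0 `<=` U].

(* As for the library's norms, values are nonnegative elements of K, hence
   nonnegative reals also when K is the complex plane. *)
Definition is_norm (p : E -> K) : Prop :=
  [/\ forall x, 0 <= p x,
      forall x, p x = 0 -> x = 0,
      forall (a : K) x, p (a *: x) = `|a| * p x &
      forall x y, p (x + y) <= p x + p y].

End SubspaceNotions.

Definition has_continuous_norm (K : numFieldType) (E : tvsType K) : Prop :=
  exists2 p : E -> K^o, is_norm p & continuous p.

Definition increasing_index (mu : nat -> nat) : Prop :=
  {homo mu : m n / (m < n)%N}.

Definition subsequence_of (nu mu : nat -> nat) : Prop :=
  exists2 phi, increasing_index phi & nu = mu \o phi.

Definition canonical_seq (K : numFieldType) (k : nat) : nat -> K^o :=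
  fun n => (n == k)%:R.

Definition polynomials (K : numFieldType) : set (nat -> K^o) :=
  lin_span (range (canonical_seq K)).

Section UniversalSeries.
Context {K : numFieldType} {P : {pred (nat -> K^o)}}.
Context {E X : tvsType K} {A : tvsSeqType P}.

(* x n k stands for x_{n,k}; only the entries with k <= n are ever used. *)
Record standing_assumptions (f : nat -> E) (x : nat -> nat -> X)
    (T0 : {linear E -> A}) : Prop := StandingAssumptions {
  polynomials_sub : @polynomials K `<=` [set` P];
  polynomials_dense : dense [set a : A | @polynomials K (val a)];
  coordinate_continuous : forall k, continuous (fun a : A => val a k : K^o);
  span_f_dense : dense (lin_span (range f));
  T0_continuous : continuous T0;
  T0_f : forall k, val (T0 (f k)) = canonical_seq K k;
  x_cvg : forall k, exists l : X, x n k @[n --> \oo] --> l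
}.

Definition SF (f : nat -> E) (n : nat) (a : A) : E :=
  \sum_(k < n.+1) (val a k : K) *: f k.

Definition SX (x : nat -> nat -> X) (n : nat) (a : A) : X :=
  \sum_(k < n.+1) (val a k : K) *: x n k.

Definition universal (x : nat -> nat -> X) (T0 : E -> A) (mu : nat -> nat) :
    set E :=
  [set g | [set: X] = closure (range (fun n => SX x (mu n) (T0 g)))].

Definition restricted_universal (f : nat -> E) (x : nat -> nat -> X)
    (T0 : E -> A) (mu : nat -> nat) : set E :=
  [set g | [set: X] `*` [set 0 : E] `<=`
    closure (range (fun n =>
      (SX x (mu n) (T0 g), g - SF f (mu n) (T0 g))))].

End UniversalSeries.

(* Main.v *)
(** Both parts concern a sequence of continuous linear maps L_n : E -> Y and a
    subspace Z of Y, an element g being universal when Z lies in the closure of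
    {L_n g}: for generalized universal series Y = Z = X and L_n = S^X_(mu_n) o T_0;
    for restricted ones Y = X x E, Z = X x {0} and
    L_n g = (S^X_(mu_n)(T_0 g), g - S^F_(mu_n)(T_0 g)).  On the dense span of the
    f_k the L_n converge pointwise to a map into Z.

    The hypothesis on all subsequences says that, for each z in Z and each
    neighbourhood of 0 in E, all but finitely many L_n send some element of that
    neighbourhood near z.  One can therefore perturb a sequence (u_k) of elements
    of the span step by step: at step i an index n_i is chosen and tiny
    corrections are added to u_0, ..., u_i so that L_(n_i) sends one of the
    corrected vectors near a prescribed target and all the others near 0.  In the
    limit every nonzero combination of the corrected vectors g_k is universal.
    With one vector this replaces Baire's theorem; with u_k running through the
    f_j infinitely often, the g_k span a dense subspace; with (u_k) a basic
    sequence (Mazur), chosen so that the coordinates of u_k up to mu_(n_i) vanish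
    for i < k, the closed span of the g_k consists of convergent series
    sum c_k g_k with coefficients bounded through the continuous norm, and its
    nonzero elements are still universal. *)

(* Universal vectors are not stable under sums, so a subspace of them cannot be assembled from
   vectors found one at a time: at each step a single index must serve all the vectors treated so
   far. Plain attainability gives an index that depends on the target; attainability at all large
   indices gives a common one. If it failed for some target, the bad indices would form a
   subsequence without universal element. [X] is not assumed separable. The countable family of
   targets comes from attainability itself, which makes the combinations of the [x n k] with scalars
   from a countable dense set dense. The vectors u_k cannot be fixed in advance, since u_k depends
   on n_(k-1). A basic sequence is therefore built beforehand, and the u_k are a subsequence of it
   read off along the construction; the basis constant 2 survives. The continuous norm enters as the
   seminorm [q 0], which bounds coefficients by sums; each [q m] obeys the basis inequality only
   from rank m on, which suffices for convergence. Increasing seminorms replace the metrics because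
   homogeneity turns continuity into an inequality [p x <= C * q m x]. *)
Require Import Defs.
From HB Require Import structures.
From mathcomp Require Import all_boot all_order all_algebra.
From mathcomp Require Import all_classical all_reals all_analysis.
From mathcomp Require Import borel_hierarchy complex.
From mathcomp Require Import ring lra zify.

Set Implicit Arguments.
Unset Strict Implicit.
Unset Printing Implicit Defensive.

Import Order.TTheory GRing.Theory Num.Theory.
Import numFieldNormedType.Exports.

Local Open Scope classical_set_scope.
Local Open Scope ring_scope.

(** * Scalars, seminorms and the Hahn-Banach theorem *)

(* What the proof needs of the real and of the complex field: [emb] embeds the
   reals, [nm] and [re] are the real-valued modulus and real part. *)
Record scalars (R : realType) (K : numFieldType) := Scalars {
  emb : {rmorphism R -> K};
  nm : K -> R;
  re : K -> R;
  nmE : forall a, `|a| = emb (nm a);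
  emb_le : {mono emb : s t / s <= t};
  re_le_nm : forall a, re a <= nm a;
  linear_of_re : forall (V : lmodType K) (l : V -> R),
    {morph l : x y / x + y} -> (forall t x, l (emb t *: x) = t * l x) ->
    exists phi : {linear V -> K^o}, forall x, re (phi x) = l x;
  disc_net : forall C e : R, 0 < e -> exists s : seq K,
    forall a, nm a <= C -> exists2 b, b \in s & nm (a - b) < e;
  scalar_complete : forall u : nat -> K,
    (forall e : R, 0 < e -> exists N, forall m n,
      (N <= m)%N -> (N <= n)%N -> nm (u m - u n) < e) ->
    exists l, forall e : R, 0 < e -> exists N, forall n,
      (N <= n)%N -> nm (u n - l) < e
}.

Section Scalars.
Context {R : realType} {K : numFieldType} (S : scalars R K).
Implicit Types (a b : K) (s t : R).

Lemma emb_inj : injective (emb S).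
Proof. by move=> s t st; apply/eqP; rewrite eq_le -!(emb_le S) st lexx. Qed.

Lemma nm_ge0 a : 0 <= nm S a.
Proof. by rewrite -(emb_le S) rmorph0 -nmE. Qed.

Lemma nmM a b : nm S (a * b) = nm S a * nm S b.
Proof. by apply: emb_inj; rewrite rmorphM -!nmE normrM. Qed.

Lemma nmN a : nm S (- a) = nm S a.
Proof. by apply: emb_inj; rewrite -!nmE normrN. Qed.

Lemma nm_emb t : nm S (emb S t) = `|t|.
Proof.
wlog t0 : t / 0 <= t => [h|].
  have [/h//|/ltW t0] := leP 0 t.
  by rewrite -nmN -rmorphN h ?normrN// oppr_ge0.
by apply: emb_inj; rewrite -nmE !ger0_norm// -(rmorph0 (emb S)) emb_le.
Qed.

Lemma nm0 : nm S 0 = 0.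
Proof. by rewrite -(rmorph0 (emb S)) nm_emb normr0. Qed.

Lemma nm1 : nm S 1 = 1.
Proof. by rewrite -(rmorph1 (emb S)) nm_emb normr1. Qed.

Lemma nm_eq0 a : (nm S a == 0) = (a == 0).
Proof. by rewrite -(inj_eq emb_inj) -nmE rmorph0 normr_eq0. Qed.

Lemma nm_gt0 a : (0 < nm S a) = (a != 0).
Proof. by rewrite lt0r nm_ge0 andbT nm_eq0. Qed.

Lemma nmV a : nm S a^-1 = (nm S a)^-1.
Proof. by apply: emb_inj; rewrite fmorphV -!nmE normfV. Qed.

Definition seminorm (V : lmodType K) (p : V -> R) :=
  [/\ forall x, 0 <= p x,
      forall a x, p (a *: x) = nm S a * p x &
      forall x y, p (x + y) <= p x + p y].

Section Seminorm.
Context (V : lmodType K) (p : V -> R) (hp : seminorm p).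

Lemma sn_ge0 x : 0 <= p x. Proof. by case: hp. Qed.
Lemma snZ a x : p (a *: x) = nm S a * p x. Proof. by case: hp. Qed.
Lemma snD x y : p (x + y) <= p x + p y. Proof. by case: hp. Qed.

Lemma sn0 : p 0 = 0. Proof. by rewrite -(scale0r 0) snZ nm0 mul0r. Qed.
Lemma snN x : p (- x) = p x.
Proof. by rewrite -scaleN1r snZ nmN nm1 mul1r. Qed.
Lemma snC x y : p (x - y) = p (y - x). Proof. by rewrite -snN opprB. Qed.
Lemma sn_tri y x z : p (x - z) <= p (x - y) + p (y - z).
Proof. by rewrite (le_trans _ (snD _ _))// addrA subrK. Qed.
Lemma sn_sub x y : p x <= p (x - y) + p y.
Proof. by rewrite (le_trans _ (snD _ _))// subrK. Qed.
Lemma snB x y : p (x - y) <= p x + p y.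
Proof. by rewrite -(snN y) snD. Qed.

Lemma sn_sum (I : Type) (s : seq I) (P : pred I) (F : I -> V) :
  p (\sum_(i <- s | P i) F i) <= \sum_(i <- s | P i) p (F i).
Proof.
elim/big_ind2: _ => [|x1 y1 x2 y2 h1 h2|//]; first by rewrite sn0.
by rewrite (le_trans (snD _ _))// lerD.
Qed.

End Seminorm.

(** * The Hahn-Banach theorem for seminorms *)

Section HahnBanach.
Context (V : lmodType K).
Implicit Types (g h : V -> R) (x y : V).

Definition sublinear g :=
  (forall x y, g (x + y) <= g x + g y) /\
  (forall t x, 0 < t -> g (emb S t *: x) <= t * g x).

Lemma sublinearZ g t x : sublinear g -> 0 < t -> g (emb S t *: x) = t * g x.
Proof.
move=> [_ gZ] t0; apply/eqP; rewrite eq_le gZ//=.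
have := gZ t^-1 (emb S t *: x); rewrite invr_gt0 => /(_ t0).
rewrite scalerA -rmorphM mulVf ?gt_eqF// rmorph1 scale1r.
by rewrite ler_pdivlMl.
Qed.

Lemma sublinear0 g : sublinear g -> g 0 = 0.
Proof.
move=> gS; have := @sublinearZ g 2 0 gS; rewrite scaler0 => /(_ ltac:(lra)) h.
lra.
Qed.

Lemma sublinearN g x : sublinear g -> - g (- x) <= g x.
Proof.
by move=> gS; have := gS.1 x (- x); rewrite subrr sublinear0//; lra.
Qed.

(** The minorant is [h x = inf_(t >= 0) (g (x + t y) - t g y)]: t = 0 gives [h x <= g x], and t = 1
    at [- y] gives the second bound. When [g] is minimal, [h = g] and the second bound makes [g]
    odd. *)
Lemma sublinear_shift g y : sublinear g ->
  exists2 h, sublinear h & (forall x, h x <= g x) /\ h (- y) <= - g y.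
Proof.
move=> gS; pose B x := [set g (x + emb S t *: y) - t * g y | t in [set t | 0 <= t]].
have Bmem x t : 0 <= t -> B x (g (x + emb S t *: y) - t * g y) by exists t.
have lbB x : lbound (B x) (- g (- x)).
  move=> _ [t /= t0 <-]; have [<-|] := eqVneq 0 t; last rewrite eq_sym => tn0.
    by rewrite rmorph0 scale0r mul0r addr0 subr0 sublinearN.
  have {}t0 : 0 < t by rewrite lt0r tn0.
  rewrite -(sublinearZ _ gS t0).
  by have := gS.1 (x + emb S t *: y) (- x); rewrite addrC addKr; lra.
have B0 x : B x !=set0 by exists (g (x + emb S 0 *: y) - 0 * g y); exact: Bmem.
have hle x (b : R) : B x b -> inf (B x) <= b.
  by move=> Bb; apply: ge_inf => //; exists (- g (- x)).
exists (fun x => inf (B x)); first split.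
- move=> x1 x2; rewrite -lerBlDr; apply: lb_le_inf => // _ [t1 /= t10 <-].
  rewrite lerBlDr -lerBlDl. apply: lb_le_inf => // _ [t2 /= t20 <-].
  rewrite lerBlDr; apply: le_trans (hle _ _ (Bmem _ (t1 + t2) _)) _.
    exact: addr_ge0.
  rewrite rmorphD scalerDl addrACA.
  by have := gS.1 (x1 + emb S t1 *: y) (x2 + emb S t2 *: y); lra.
- move=> t x t0; rewrite mulrC -ler_pdivrMr//.
  apply: lb_le_inf => // _ [s /= s0 <-]; rewrite ler_pdivrMr//.
  apply: le_trans (hle _ _ (Bmem _ (t * s) _)) _; first by rewrite mulr_ge0// ltW.
  by rewrite rmorphM -scalerA -scalerDr sublinearZ// le_eqVlt; apply/orP/or_introl/eqP; ring.
- split=> [x|].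
    by apply: le_trans (hle _ _ (Bmem _ 0 _)) _; rewrite // rmorph0 scale0r mul0r addr0 subr0.
  apply: le_trans (hle _ _ (Bmem _ 1 _)) _ => //.
  by rewrite rmorph1 scale1r addNr mul1r sublinear0// sub0r.
Qed.

(* A sublinear functional that is minimal for the pointwise order is linear, so
   that Zorn's lemma can be applied to total functions. *)
Lemma minimal_sublinear g : sublinear g ->
  exists2 l, sublinear l & (forall x, l x <= g x) /\
    forall h, sublinear h -> (forall x, h x <= l x) -> h = l.
Proof.
move=> gS; pose T := {h : V -> R | sublinear h /\ forall x, h x <= g x}.
pose Rel (h1 h2 : T) := `[< forall x, sval h2 x <= sval h1 x >].
have [||||[l [lS lg]] lmin] := @Zorn T Rel.
- by move=> h; apply/asboolP.
- move=> h1 h2 h3 /asboolP h12 /asboolP h23; apply/asboolP => x.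
  exact: le_trans (h23 x) (h12 x).
- move=> [h1 H1] [h2 H2] /asboolP /= h12 /asboolP /= h21.
  by apply/eq_exist/funext => x; apply/eqP; rewrite eq_le h12 h21.
- move=> A Atot; have [[h0 Ah0]|/forallNP A0] := pselect (exists h : T, A h); last first.
    exists (exist _ g (conj gS (fun x => lexx _))) => h /A0.
    by [].
  pose B x := [set sval h x | h in A].
  have lbB x : lbound (B x) (- g (- x)).
    move=> _ [[h [hS hg]] Ah <-] /=; rewrite (le_trans _ (sublinearN x hS))//.
    by rewrite lerN2.
  have B0 x : B x !=set0 by exists (sval h0 x), h0.
  have hle (h : T) x : A h -> inf (B x) <= sval h x.
    by move=> Ah; apply: ge_inf; [exists (- g (- x)) | exists h].
  (* Subadditivity survives the infimum because of two members of the chain the smaller one can be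
     used in both terms. *)
  have iS : sublinear (fun x => inf (B x)).
    split=> [x y|t x t0].
      rewrite -lerBlDr; apply: lb_le_inf => // _ [h1 A1 <-].
      rewrite lerBlDr -lerBlDl; apply: lb_le_inf => // _ [h2 A2 <-].
      rewrite lerBlDr.
      have [/asboolP h12|/asboolP h21] := Atot _ _ A1 A2.
        apply: le_trans (hle h2 _ A2) _; apply: le_trans ((svalP h2).1.1 x y) _.
        by rewrite addrC lerD2l.
      apply: le_trans (hle h1 _ A1) _; apply: le_trans ((svalP h1).1.1 x y) _.
      by rewrite addrC lerD2r.
    rewrite mulrC -ler_pdivrMr//; apply: lb_le_inf => // _ [h Ah <-].
    rewrite ler_pdivrMr//; apply: le_trans (hle h _ Ah) _.
    by rewrite mulrC; exact: (svalP h).1.2.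
  have ig x : inf (B x) <= g x := le_trans (hle _ x Ah0) ((svalP h0).2 x).
  exists (exist (fun h => sublinear h /\ forall x, h x <= g x) _ (conj iS ig)).
  move=> h Ah; apply/asboolP => x /=.
  exact: hle.
- exists l => //; split => // h hS hl.
  have hg x : h x <= g x := le_trans (hl x) (lg x).
  have /lmin[] : Rel (exist _ l (conj lS lg)) (exist _ h (conj hS hg)).
    exact/asboolP.
  by [].
Qed.

(** Shifting [p] along [y] before minimizing forces [l (- y) <= - p y] for the minimal [l] below,
    hence equality at [y]. Minimality makes [l] odd, so its subadditivity, applied to opposites,
    becomes additivity. The scalar field then supplies the linear form with real part [l]. *)
Lemma hahn_banach (p : V -> R) y : seminorm p ->
  exists2 phi : {linear V -> K^o},
    forall x, re S (phi x) <= p x & re S (phi y) = p y.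
Proof.
move=> hp; have pS : sublinear p.
  split=> [x z|t x t0]; first exact: snD.
  by rewrite (snZ hp) nm_emb gtr0_norm.
have [p' p'S [p'p p'y]] := sublinear_shift y pS.
have [l lS [lp' lmin]] := minimal_sublinear p'S.
have lN x : l (- x) = - l x.
  have [h hS [hl hx]] := sublinear_shift x lS.
  move: hx; rewrite (lmin h hS hl) => hx.
  by have := sublinearN (- x) lS; rewrite opprK => h1; apply/eqP; rewrite eq_le hx.
have lD : {morph l : x z / x + z}.
  move=> x z; apply/eqP; rewrite eq_le lS.1/=.
  by have := lS.1 (- x) (- z); rewrite -opprD !lN; lra.
have lZ t x : l (emb S t *: x) = t * l x.
  have [t0|t0|<-] := ltgtP 0 t; first by rewrite sublinearZ.
    rewrite -[t]opprK rmorphN scaleNr lN sublinearZ ?oppr_gt0//; ring.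
  by rewrite rmorph0 scale0r mul0r sublinear0.
have [phi phiE] := linear_of_re lD lZ.
exists phi => [x|]; rewrite phiE; first exact: le_trans (lp' x) (p'p x).
apply/eqP; rewrite eq_le (le_trans (lp' y) (p'p y))/=.
by have := le_trans (lp' (- y)) p'y; rewrite lN lerN2.
Qed.

End HahnBanach.

End Scalars.

(** * Increasing sequences of seminorms *)

Section FundamentalSystem.
Context {R : realType} {K : numFieldType} (S : scalars R K) (V : lmodType K).

Definition fundamental (q : nat -> V -> R) :=
  (forall n, seminorm S (q n)) /\ (forall n x, q n x <= q n.+1 x).

Definition scvg (q : nat -> V -> R) (u : nat -> V) (l : V) :=
  forall m (e : R), 0 < e -> exists N, forall n, (N <= n)%N -> q m (u n - l) < e.

Definition scomplete (q : nat -> V -> R) :=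
  forall u : nat -> V,
    (forall m (e : R), 0 < e -> exists N, forall i j,
       (N <= i)%N -> (N <= j)%N -> q m (u i - u j) < e) ->
    exists l, scvg q u l.

(** Continuity of a seminorm for the topology of an increasing system [q], in quantitative form. *)
Definition dominated (q : nat -> V -> R) (p : V -> R) :=
  seminorm S p /\ exists m C, 0 < C /\ forall x, p x <= C * q m x.

Context (q : nat -> V -> R) (hq : fundamental q).

Lemma fund_sn n : seminorm S (q n). Proof. exact: hq.1. Qed.

Lemma fund_le m n x : (m <= n)%N -> q m x <= q n x.
Proof.
move=> /subnKC <-; elim: (n - m)%N => [|k IH]; first by rewrite addn0.
by rewrite addnS (le_trans IH)// hq.2.
Qed.

Lemma dominated_small p e : dominated q p -> 0 < e ->
  exists m d, 0 < d /\ forall x, q m x < d -> p x < e.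
Proof.
move=> [_ [m [C [C0 pC]]]] e0; exists m, (e / C); split; first exact: divr_gt0.
by move=> x; rewrite ltr_pdivlMr// mulrC; exact: le_lt_trans.
Qed.

Lemma scvg_dominated p u l e : dominated q p -> scvg q u l -> 0 < e ->
  exists N, forall n, (N <= n)%N -> p (u n - l) < e.
Proof.
move=> pq ul /(dominated_small pq)[m [d [d0 h]]].
by have [N hN] := ul m d d0; exists N => n /hN/h.
Qed.

Lemma dominated_fund m : dominated q (q m).
Proof.
split; first exact: fund_sn.
by exists m, 1; split => // x; rewrite mul1r.
Qed.

End FundamentalSystem.

Section FiniteSpan.
Context {K : numFieldType} {V : lmodType K}.
Implicit Types (w : nat -> V) (c : nat -> K).

Definition fspan w := [set x : V | exists N c, x = \sum_(k < N) c k *: w k].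

Lemma sum_pad w N N' c : (N <= N')%N ->
  \sum_(k < N) c k *: w k = \sum_(k < N') (if (k < N)%N then c k else 0) *: w k.
Proof.
move=> NN'; rewrite (big_ord_widen _ (fun k => c k *: w k) NN') big_mkcond.
by apply: eq_bigr => k _; case: ifP; rewrite ?scale0r.
Qed.

Lemma fspan0 w : fspan w 0.
Proof. by exists 0%N, (fun=> 0); rewrite big_ord0. Qed.

Lemma fspan_linear w a x y : fspan w x -> fspan w y -> fspan w (a *: x + y).
Proof.
move=> [N [c ->]] [N' [c' ->]]; exists (maxn N N').
exists (fun k => a * (if (k < N)%N then c k else 0) +
                 (if (k < N')%N then c' k else 0)).
rewrite (sum_pad _ _ (leq_maxl N N')) (sum_pad _ _ (leq_maxr N N')).
rewrite scaler_sumr -big_split/=; apply: eq_bigr => k _.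
by rewrite scalerDl scalerA.
Qed.

Lemma fspan_mem w k : fspan w (w k).
Proof.
exists k.+1, (fun j => (j == k)%:R); rewrite (bigD1 ord_max)//= eqxx scale1r.
by rewrite big1 ?addr0// => j /negPf; rewrite -val_eqE/= => ->; rewrite scale0r.
Qed.

End FiniteSpan.

Lemma geometric_gt0 (R : realType) (e : R) n : 0 < e -> 0 < e / 2 ^+ n.
Proof. by move=> e0; rewrite divr_gt0// exprn_gt0. Qed.

Lemma geometricS (R : realType) (e : R) n : e / 2 ^+ n.+1 = e / 2 ^+ n / 2.
Proof. by rewrite exprSr invfM mulrA. Qed.

Lemma geometric_le (R : realType) (e : R) m n : 0 <= e -> (m <= n)%N ->
  e / 2 ^+ n <= e / 2 ^+ m.
Proof.
move=> e0 mn; rewrite ler_wpM2l// lef_pV2 ?posrE ?exprn_gt0//.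
by rewrite ler_weXn2l// ler1n.
Qed.

Lemma geometric_small (R : realType) (C e : R) : 0 < e ->
  exists N, forall n, (N <= n)%N -> C / 2 ^+ n < e.
Proof.
move=> e0; pose M := `|C| / e; have M0 : 0 <= M by rewrite divr_ge0// ltW.
exists (Num.bound M) => n hn; rewrite (le_lt_trans (ler_norm _))//.
rewrite normrM normfV normrX (@ger0_norm _ 2)// ltr_pdivrMr ?exprn_gt0//.
rewrite -ltr_pdivrMl// mulrC.
apply: lt_le_trans (archi_boundP M0) _.
rewrite -natrX ler_nat (leq_trans hn)// ltnW//; exact: ltn_expl.
Qed.

Lemma geometric_sum_le (R : realType) (e : R) m n : 0 <= e ->
  \sum_(m <= i < n) e / 2 ^+ i <= 2 * (e / 2 ^+ m).
Proof.
move=> e0; have [nm|/ltnW mn] := leqP n m.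
  by rewrite big_geq// mulr_ge0// divr_ge0// exprn_ge0.
suff -> : \sum_(m <= i < n) e / 2 ^+ i = 2 * (e / 2 ^+ m) - 2 * (e / 2 ^+ n).
  by rewrite gerBl mulr_ge0// divr_ge0// exprn_ge0.
elim: n mn => [|n IH]; first by rewrite leqn0 => /eqP ->; rewrite big_geq// subrr.
rewrite leq_eqVlt => /predU1P[->|]; first by rewrite big_geq// subrr.
rewrite ltnS => mn; rewrite big_nat_recr//= IH// geometricS; lra.
Qed.

Section Telescoping.
Context {R : realType} {K : numFieldType} (S : scalars R K) (V : lmodType K).
Context (q : nat -> V -> R) (hq : fundamental S q).

Lemma telescope_le (p : V -> R) (u : nat -> V) (e : R) j i :
  seminorm S p -> 0 <= e ->
  (forall k, (j <= k)%N -> p (u k.+1 - u k) <= e / 2 ^+ k) -> (j <= i)%N ->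
  p (u i - u j) <= 2 * (e / 2 ^+ j).
Proof.
move=> hp e0 hu ji; apply: le_trans (geometric_sum_le j i e0).
elim: i ji => [|i IH]; first by rewrite leqn0 => /eqP->; rewrite subrr (sn0 hp) big_geq.
rewrite leq_eqVlt => /predU1P[->|]; first by rewrite subrr (sn0 hp) big_geq.
rewrite ltnS => ji; rewrite big_nat_recr//= addrC.
by apply: le_trans (sn_tri hp (u i) _ _) _; rewrite lerD ?hu ?IH.
Qed.

(** The k-th increment is measured in [q k]; since the seminorms increase, every fixed [q m] sees a
    geometric tail from rank m on. *)
Lemma telescope_cvg (u : nat -> V) (e : R) j : scomplete q -> 0 <= e ->
  (forall k, (j <= k)%N -> q k (u k.+1 - u k) <= e / 2 ^+ k) ->
  exists l, scvg q u l.
Proof.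
move=> cq e0 hu; apply: cq => m d d0.
have [N hN] := geometric_small (4 * e) d0.
pose M := maxn N (maxn m j).
have [NM mM jM] : [/\ (N <= M)%N, (m <= M)%N & (j <= M)%N] by rewrite /M; split; lia.
have H k : (M <= k)%N -> q m (u k - u M) <= 2 * (e / 2 ^+ M).
  move=> Mk; apply: (telescope_le (fund_sn hq m)) => // l Ml.
  by apply: le_trans (hu _ _); [apply: (fund_le hq); lia | lia].
exists M => i i' Mi Mi'.
apply: le_lt_trans (sn_tri (fund_sn hq m) (u M) _ _) _.
rewrite (snC (fund_sn hq m) (u M)).
have := H i Mi; have := H i' Mi'; have := hN M NM; rewrite -mulrA; lra.
Qed.

Lemma le_dominated_limit p (u : nat -> V) l y C j : dominated S q p ->
  scvg q u l -> (forall i, (j <= i)%N -> p (u i - y) <= C) -> p (l - y) <= C.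
Proof.
move=> pq ul h; apply/ler_addgt0Pl => e e0.
have [N hN] := scvg_dominated pq ul e0.
apply: le_trans (sn_tri pq.1 (u (maxn N j)) _ _) _.
rewrite (snC pq.1) lerD//; first by apply/ltW/hN; lia.
by apply: h; lia.
Qed.

End Telescoping.

(** * Universality and attainability for an abstract sequence of linear maps *)

Section Universality.
Context {R : realType} {K : numFieldType} (S : scalars R K) (E Y : lmodType K).
Context (q : nat -> E -> R) (hq : fundamental S q).
Context (r : nat -> Y -> R) (hr : fundamental S r).
Context (Z : set Y) (Z0 : Z 0) (Zlin : forall a x y, Z x -> Z y -> Z (a *: x + y)).
Context (D : set E) (D0 : D 0) (Dlin : forall a x y, D x -> D y -> D (a *: x + y)).
Context (Ddense : forall x m (e : R), 0 < e -> exists2 h, D h & q m (x - h) < e).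

Definition univ (L : nat -> E -> Y) (x : E) :=
  forall z m (e : R), Z z -> 0 < e -> exists n, r m (L n x - z) < e.

Definition attainable (L : nat -> E -> Y) :=
  forall z m (e : R), Z z -> 0 < e ->
    exists n s, q m s < e /\ r m (L n s - z) < e.

Definition attainable_cofinal (L : nat -> E -> Y) :=
  forall z m (e : R) N, Z z -> 0 < e ->
    exists n s, [/\ (N <= n)%N, q m s < e & r m (L n s - z) < e].

Definition attainable_eventually (L : nat -> E -> Y) :=
  forall z m (e : R), Z z -> 0 < e -> exists N, forall n, (N <= n)%N ->
    exists s, q m s < e /\ r m (L n s - z) < e.

Definition converges_on (L : nat -> E -> Y) :=
  forall h, D h -> exists2 l, Z l & scvg r (fun n => L n h) l.

Lemma ZD x y : Z x -> Z y -> Z (x + y).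
Proof. by move=> Zx Zy; rewrite -[x]scale1r; exact: Zlin. Qed.

Lemma DD x y : D x -> D y -> D (x + y).
Proof. by move=> Dx Dy; rewrite -[x]scale1r; exact: Dlin. Qed.

(* A nontrivial subspace has no isolated point: approximating z' instead of z
   rules out any given finite set of indices. *)
Lemma avoid_point z1 m1 z p m (e : R) : Z z1 -> 0 < r m1 z1 -> Z z -> 0 < e ->
  exists z', [/\ Z z', r m (z' - z) < e & 0 < r m1 (p - z')].
Proof.
move=> Zz1 z10 Zz e0; have rS := fund_sn hr.
have [pz|pz] := ltP 0 (r m1 (p - z)); first by exists z; rewrite subrr (sn0 (rS m)).
pose t := e / (2 * (r m z1 + 1)); have rm0 := sn_ge0 (rS m) z1.
have t0 : 0 < t by rewrite divr_gt0//; lra.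
exists (emb S t *: z1 + z); split; first exact: Zlin.
  rewrite addrK (snZ (rS m)) nm_emb gtr0_norm// /t mulrAC ltr_pdivrMr; last lra.
  by rewrite ltr_pM2l//; lra.
have := sn_sub (rS m1) (emb S t *: z1) (p - z).
have -> : emb S t *: z1 - (p - z) = - (p - (emb S t *: z1 + z)).
  by rewrite !opprB addrA addrAC.
rewrite (snN (rS m1)) (snZ (rS m1)) nm_emb gtr0_norm//.
by have := mulr_gt0 t0 z10; lra.
Qed.

Section Maps.
Context (L : nat -> {linear E -> Y}).
Context (Ldom : forall n i, dominated S q (fun x => r i (L n x))).

Lemma small_images N i (e : R) : 0 < e ->
  exists m d, 0 < d /\ forall s, q m s < d -> forall l, (l <= N)%N -> r i (L l s) < e.
Proof.
move=> e0; elim: N => [|N [m [d [d0 IH]]]].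
  have [m [d [d0 h]]] := dominated_small (Ldom 0 i) e0.
  by exists m, d; split => // s /h hs l; rewrite leqn0 => /eqP ->.
have [m' [d' [d'0 h]]] := dominated_small (Ldom N.+1 i) e0.
exists (maxn m m'), (Num.min d d'); split; first by rewrite lt_min d0.
move=> s; rewrite lt_min => /andP[sd sd'] l; rewrite leq_eqVlt => /predU1P[->|].
  by apply: h; apply: le_lt_trans sd'; apply: (fund_le hq); lia.
rewrite ltnS; apply: IH; apply: le_lt_trans sd; apply: (fund_le hq); lia.
Qed.

(** The maps of index at most N send all sufficiently small vectors near 0, so they cannot reach a
    target that stays away from 0. The target [z] is first moved to a nearby nonzero [z'], and the
    precision is taken below half the size of [z']. *)
Lemma attainable_cofinalP : attainable L -> attainable_cofinal L.
Proof.
move=> aL z m e N Zz e0; have rS := fund_sn hr.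
(* If every seminorm vanishes on [Z], all targets look like 0 and the vector 0 attains them. *)
have [[z1 Zz1 [m1 z10]]|deg] := pselect (exists2 z1, Z z1 & exists m1, 0 < r m1 z1); last first.
  exists N, 0; split=> //; first by rewrite (sn0 (fund_sn hq m)).
  rewrite linear0 sub0r (snN (rS m)) ltNge; apply/negP => ez; apply: deg.
  by exists z => //; exists m; exact: lt_le_trans ez.
have [|z' [Zz' zz' rz']] := @avoid_point z1 m1 z 0 m (e / 2) Zz1 z10 Zz.
  by rewrite divr_gt0.
rewrite sub0r (snN (rS m1)) in rz'.
pose e1 := r m1 z' / 2; have e10 : 0 < e1 by rewrite divr_gt0.
have [m2 [d [d0 hd]]] := small_images N m1 e10.
pose M := maxn m (maxn m1 m2).
have [mM m1M m2M] : [/\ (m <= M)%N, (m1 <= M)%N & (m2 <= M)%N].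
  by rewrite /M !leq_max !leqnn !orbT.
pose e' := Num.min (e / 2) (Num.min e1 d).
have e'0 : 0 < e' by rewrite !lt_min e10 d0 andbT divr_gt0.
have [n [s []]] := aL z' M e' Zz' e'0; rewrite !lt_min.
move=> /and3P[s1 _ s3] /and3P[t1 t2 _]; exists n, s.
have qle k : (k <= M)%N -> q k s <= q M s by exact: (fund_le hq).
have rle k y : (k <= M)%N -> r k y <= r M y by exact: (fund_le hr).
split.
- rewrite leqNgt; apply/negP => /ltnW nN.
  have /hd/(_ n nN) : q m2 s < d by apply: le_lt_trans s3; exact: qle.
  have : r m1 (L n s - z') < e1 by apply: le_lt_trans t2; exact: rle.
  have := sn_sub (rS m1) z' (L n s); rewrite (snC (rS m1)) /e1; lra.
- by have := qle m mM; lra.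
- have := sn_tri (rS m) z' (L n s) z; have := rle m (L n s - z') mM; lra.
Qed.

(** Subtract from the universal vector [x] some [h] of [D] close to it: [x - h] is small, and if
    [L n h] tends to [l], then [L n (x - h)] is near [z] as soon as [L n x] is near [z + l]. This
    has to happen at a large [n], whence [cof]. *)
Lemma univ_attainable : converges_on L -> (exists x, univ L x) -> attainable L.
Proof.
move=> cL [x ux] z m e Zz e0; have rS := fund_sn hr.
have [[z1 Zz1 [m1 z10]]|deg] := pselect (exists2 z1, Z z1 & exists m1, 0 < r m1 z1); last first.
  exists 0%N, 0; split=> //; first by rewrite (sn0 (fund_sn hq m)).
  rewrite linear0 sub0r (snN (rS m)) ltNge; apply/negP => ez; apply: deg.
  by exists z => //; exists m; exact: lt_le_trans ez.
(* Index N is excluded by aiming at a point [z'] different from [L N x], with a precision at most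
   their distance. *)
have cof N : forall z m e, Z z -> 0 < e -> exists n, (N <= n)%N /\ r m (L n x - z) < e.
  elim: N => [|N IH] {m z e Zz e0} z m e Zz e0.
    by have [n hn] := ux z m e Zz e0; exists n.
  have [|z' [Zz' zz' rz']] := @avoid_point z1 m1 z (L N x) m (e / 2) Zz1 z10 Zz.
    by rewrite divr_gt0.
  pose e' := Num.min (e / 2) (r m1 (L N x - z')).
  have e'0 : 0 < e' by rewrite lt_min rz' divr_gt0.
  have [n [Nn]] := IH z' (maxn m m1) e' Zz' e'0.
  rewrite lt_min => /andP[h1 h2]; exists n; split.
    rewrite ltn_neqAle Nn andbT; apply/negP => /eqP eN; move: h2.
    rewrite -eN ltNge => /negP; apply; apply: (fund_le hr); lia.
  have := sn_tri (rS m) z' (L n x) z.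
  have := fund_le hr (L n x - z') (leq_maxl m m1); lra.
have [h Dh xh] := Ddense x m e0; have [l Zl hl] := cL h Dh.
have e20 : 0 < e / 2 by rewrite divr_gt0.
have [N hN] := hl m _ e20.
have [n [/hN Nn h1]] := cof N (z + l) m (e / 2) (ZD Zz Zl) e20.
exists n, (x - h); split => //; rewrite linearB/=.
have -> : L n x - L n h - z = (L n x - (z + l)) - (L n h - l).
  by rewrite opprB addrA opprD addrA subrK addrAC.
apply: le_lt_trans (snB (rS m) _ _) _; lra.
Qed.

End Maps.

(** A target missed at infinitely many indices is missed along a whole subsequence of maps, which
    has a universal vector and is therefore attainable: a contradiction. *)
Lemma univ_subsequences (L : nat -> {linear E -> Y}) : converges_on L ->
  (forall phi : nat -> nat, {homo phi : m n / (m < n)%N} -> exists x, univ (L \o phi) x) ->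
  attainable_eventually L.
Proof.
move=> cL hL z m e Zz e0; apply: contrapT => /forallNP bad.
pose badn n := forall s, q m s < e -> e <= r m (L n s - z).
have {}bad N : exists n, (N <= n)%N /\ badn n.
  have /existsNP[n /not_implyP[Nn hn]] := bad N; exists n; split => // s qs.
  by rewrite leNgt; apply/negP => rs; apply: hn; exists s.
have [next hnext] := choice bad.
pose phi n := iter n (fun k => next k.+1) (next 0).
have phiS : {homo phi : m n / (m < n)%N}.
  apply: homo_ltn => [?|n]; first by move=> ? ?; exact: ltn_trans.
  exact: (hnext (phi n).+1).1.
have phige N n : (N <= n)%N -> (N <= phi n)%N.
  move=> Nn; apply: leq_trans Nn _; elim: n => // n IH.
  exact: leq_ltn_trans IH (phiS _ _ (ltnSn n)).
have phibad n : badn (phi n) by case: n => [|n]; exact: (hnext _).2.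
have cphi : converges_on (L \o phi).
  move=> h /cL[l Zl hl]; exists l => // m' e' e'0.
  by have [N hN] := hl m' e' e'0; exists N => n Nn; apply/hN/phige.
have [n [s [qs]]] := @univ_attainable (L \o phi) cphi (hL _ phiS) z m e Zz e0.
by rewrite ltNge => /negP; apply; exact: phibad.
Qed.

End Universality.

(** * Simultaneous perturbation *)

Section Construction.
Context {R : realType} {K : numFieldType} (S : scalars R K) (E Y : lmodType K).
Context (q : nat -> E -> R) (hq : fundamental S q) (cq : scomplete q).
Context (r : nat -> Y -> R) (hr : fundamental S r).
Context (Z : set Y) (Z0 : Z 0) (Zlin : forall a x y, Z x -> Z y -> Z (a *: x + y)).
Context (D : set E) (D0 : D 0) (Dlin : forall a x y, D x -> D y -> D (a *: x + y)).
Context (Ddense : forall x m (e : R), 0 < e -> exists2 h, D h & q m (x - h) < e).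
Context (L : nat -> {linear E -> Y}).
Context (Ldom : forall n i, dominated S q (fun x => r i (L n x))).
Context (cL : converges_on r Z D L).

(* At step i the vectors k <= i with [act k] receive a correction in D, of size
   at most e0 / 2^i for q_i and for all r_i o L_l with l up to the previous index,
   so that later corrections do not spoil what L_(n i) already achieves.  The
   starting vector u_k may depend on the index chosen just before step k. *)
Lemma tracks (act : pred nat) (tau : nat -> nat -> Y) (U : nat -> nat -> E) (e0 : R) :
  0 < e0 -> (forall k n, D (U k n)) -> (forall i k, Z (tau i k)) ->
  (forall i z m (e : R) N, (forall k, Z (z k)) -> 0 < e -> exists n, (N <= n)%N /\
     forall k, (k <= i)%N -> act k -> exists s, q m s < e /\ r m (L n s - z k) < e) ->
  exists (n : nat -> nat) (g u : nat -> E),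
  [/\ (forall i, (n i < n i.+1)%N),
      u 0%N = U 0%N 0%N /\ (forall k, u k.+1 = U k.+1 (n k)),
      forall k, act k -> q k (g k - u k) <= 2 * (e0 / 2 ^+ k),
      forall i k, act k -> (k <= i)%N -> r i (L (n i) (g k) - tau i k) <= 2 * (e0 / 2 ^+ i) &
      forall i k, act k -> (i < k)%N -> r i (L (n i) (g k - u k)) <= 2 * (e0 / 2 ^+ k)].
Proof.
move=> e00 UD tauZ H; have qS := fund_sn hq; have rS := fund_sn hr.
(* A state is the last index chosen and the current vectors. Vector [i] enters at step [i]; entries
   beyond [i] are meaningless, since their own step overwrites them. *)
pose base i (st : nat * (nat -> E)) k := if k == i then U i st.1 else st.2 k.
pose good i (st st' : nat * (nat -> E)) := [/\ (st.1 < st'.1)%N, forall k, D (st'.2 k) &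
  forall k, (k <= i)%N -> act k -> let s := st'.2 k - base i st k in
   [/\ q i s <= e0 / 2 ^+ i,
       forall l, (l <= st.1)%N -> r i (L l s) <= e0 / 2 ^+ i &
       r i (L st'.1 (st'.2 k) - tau i k) <= e0 / 2 ^+ i]].
have stepP (p : nat * (nat * (nat -> E))) : exists st',
    (forall k, D (p.2.2 k)) -> good p.1 p.2 st'.
  case: p => i st /=; have [Dst|nD] := pselect (forall k, D (st.2 k)); last by exists st.
  have Db k : D (base i st k) by rewrite /base; case: ifP.
  have /choice[lam lamP] : forall k, exists l, Z l /\ scvg r (fun n => L n (base i st k)) l.
    by move=> k; have [l ? ?] := cL (Db k); exists l.
  pose e := e0 / 2 ^+ i; have e_gt0 : 0 < e := geometric_gt0 i e00.
  have e40 : 0 < e / 4 by rewrite divr_gt0.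
  have [m [d [d0 hd]]] := small_images hq Ldom st.1 i e_gt0.
  have [N1 hN1] : exists N, forall n, (N <= n)%N -> forall k, (k <= i)%N ->
      r i (L n (base i st k) - lam k) < e / 4.
    suff : forall j, exists N, forall n, (N <= n)%N -> forall k, (k <= j)%N ->
      r i (L n (base i st k) - lam k) < e / 4 by exact.
    elim=> [|j [N hN]].
      have [N hN] := (lamP 0%N).2 i _ e40.
      by exists N => n Nn k; rewrite leqn0 => /eqP ->; exact: hN.
    have [N' hN'] := (lamP j.+1).2 i _ e40.
    exists (maxn N N') => n Nn k; rewrite leq_eqVlt => /predU1P[->|].
      by apply: hN'; lia.
    by rewrite ltnS; apply: hN; lia.
  (* The uncorrected vector already has images tending to [lam k], so the correction must be sent
     near the difference. *)
  pose z k := tau i k - lam k.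
  have Zz k : Z (z k).
    by apply: (ZD Zlin) (tauZ i k) _; rewrite -scaleN1r -[_ *: _]addr0; apply: Zlin (lamP k).1 _.
  pose M := maxn i m; pose e' := Num.min (e / 4) (d / 2).
  (* Attaining [z k], moving the correction into [D], and the distance to [lam k] each cost [e / 4].
     Moving into [D] may double the size of the correction, hence [d / 2]. *)
  have e'0 : 0 < e' by rewrite lt_min e40 divr_gt0.
  have e'1 : e' <= e / 4 by rewrite /e' ge_min lexx.
  have e'2 : e' <= d / 2 by rewrite /e' ge_min lexx orbT.
  clearbody e'.
  have [n [Nn hn]] := H i z M e' (maxn N1 st.1.+1) Zz e'0.
  (* The correction is replaced by a nearby element of [D], so that the maps still converge on the
     corrected vectors at the next step. *)
  have /choice[s sP] : forall k, exists s, D s /\ ((k <= i)%N -> act k ->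
      q M s < 2 * e' /\ r i (L n s - z k) < e / 2).
    move=> k; have [[ki ak]|nk] := pselect ((k <= i)%N /\ act k); last first.
      by exists 0; split => // ki ak; case: nk.
    have [s [s1 s2]] := hn k ki ak.
    have [m2 [d2 [d20 hd2]]] := dominated_small (Ldom n i) e40.
    pose d3 := Num.min e' d2; have d30 : 0 < d3 by rewrite lt_min e'0.
    have [h Dh] := Ddense s (maxn M m2) d30; rewrite lt_min => /andP[h1 h2].
    exists h; split => // _ _; split.
      have := fund_le hq (s - h) (leq_maxl M m2).
      have := sn_sub (qS M) h s; rewrite (snC (qS M) h s); lra.
    have h3 : r i (L n (s - h)) < e / 4.
      by apply: hd2; apply: le_lt_trans h2; apply: (fund_le hq); exact: leq_maxr.
    have := fund_le hr (L n s - z k) (leq_maxl i m).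
    have := sn_tri (rS i) (L n s) (L n h) (z k); rewrite (snC (rS i) (L n h) (L n s)) -linearB.
    rewrite -/M; lra.
  exists (n, fun k => base i st k + s k); split => /=; first by lia.
    by move=> k; apply: (DD Dlin) => //; exact: (sP k).1.
  move=> k ki ak; rewrite [base i st k + s k]addrC addrK.
  have [s1 s2] := (sP k).2 ki ak.
  split.
  - have := fund_le hq (s k) (leq_maxl i m); rewrite -/M -/e; lra.
  - move=> l lst; apply/ltW/hd => //.
    have := fund_le hq (s k) (leq_maxr i m); rewrite -/M; lra.
  - have := hN1 n (leq_trans (leq_maxl _ _) Nn) k ki.
    have -> : L n (s k + base i st k) - tau i k = (L n (s k) - z k) + (L n (base i st k) - lam k).
      by rewrite linearD /z opprB addrACA [lam k - _ - _]addrAC subrr add0r.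
    have := snD (rS i) (L n (s k) - z k) (L n (base i st k) - lam k).
    rewrite -/e; lra.
have [step stepE] := choice stepP.
pose st := fix st i := if i is i'.+1 then step (i', st i') else (0%N, fun=> 0).
have Dst i k : D ((st i).2 k).
  by elim: i k => [//|i IH] k; have [_ ] := stepE (i, st i) IH.
have stG i : good i (st i) (st i.+1) := stepE (i, st i) (Dst i).
pose n i := (st i.+1).1; pose u k := U k (st k).1.
have base_lt i k : (k < i)%N -> base i (st i) k = (st i).2 k.
  by rewrite /base => ki; rewrite ltn_eqF.
have base_eq k : base k (st k) k = u k by rewrite /base eqxx.
have n_mono i j : (i <= j)%N -> ((st i).1 <= (st j).1)%N.
  move=> /subnKC <-; elim: (j - i)%N => [|d IH]; first by rewrite addn0.
  by rewrite addnS (leq_trans IH)// ltnW//; case: (stG (i + d)%N).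
(* The history of vector k, frozen at its starting value until step k, so that all increments from k
   on are corrections. *)
pose G k i := if (i <= k)%N then u k else (st i).2 k.
have GS k i : (k <= i)%N -> G k i.+1 - G k i = (st i.+1).2 k - base i (st i) k.
  rewrite /G leq_eqVlt => /predU1P[<-|ki]; first by rewrite ltnn leqnn base_eq.
  by rewrite base_lt// ifN ?ifN//; lia.
have /choice[g gP] : forall k, exists g, act k -> scvg q (G k) g.
  move=> k; have [ak|nk] := boolP (act k); last by exists 0.
  have [|g hg] := @telescope_cvg _ _ S _ q hq (G k) e0 k cq (ltW e00); last by exists g.
  move=> i ki; rewrite GS//; have [_ _ /(_ k ki ak)[]] := stG i; by [].
exists n, g, u; split.
- by move=> i; have [] := stG i.+1.
- by [].
- move=> k ak; apply: (le_dominated_limit (j := k) (dominated_fund hq k) (gP k ak)) => i ki.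
  have -> : u k = G k k by rewrite /G leqnn.
  apply: (telescope_le (qS k)) ki => // [|j kj]; first exact: ltW.
  rewrite GS//; have [_ _ /(_ k kj ak)[h _ _]] := stG j.
  by apply: le_trans h; exact: (fund_le hq).
- move=> i k ak ki.
  have hi : r i (L (n i) (G k i.+1) - tau i k) <= e0 / 2 ^+ i.
    by have [_ _ /(_ k ki ak)[_ _]] := stG i; rewrite /G leqNgt ltnS ki.
  (* All corrections after step [i] together move the image by at most [2 * (e0 / 2 ^+ i.+1)], that
     is [e0 / 2 ^+ i]; added to [hi] this gives the announced factor 2. *)
  have := @le_dominated_limit _ _ S _ q _ (G k) (g k) (G k i.+1)
    (2 * (e0 / 2 ^+ i.+1)) i.+1 (Ldom (n i) i) (gP k ak).
  have h : forall i0 : nat, (i < i0)%N -> r i (L (n i) (G k i0 - G k i.+1)) <= 2 * (e0 / 2 ^+ i.+1).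
    move=> j ij; apply: (telescope_le (Ldom (n i) i).1) ij => [|l il]; first exact: ltW.
    rewrite GS; last by lia.
    have [_ _ /(_ k ltac:(lia) ak)[_ hl _]] := stG l.
    apply: le_trans (hl (n i) _); first by apply: (fund_le hr); lia.
    exact: n_mono.
  move=> /(_ h); rewrite linearB geometricS.
  by have := sn_tri (rS i) (L (n i) (G k i.+1)) (L (n i) (g k)) (tau i k); lra.
- move=> i k ak ik.
  apply: (@le_dominated_limit _ _ S _ q _ (G k) (g k) (u k) _ k (Ldom (n i) i) (gP k ak)) => j kj.
  have -> : u k = G k k by rewrite /G leqnn.
  apply: (telescope_le (Ldom (n i) i).1) kj => [|l kl]; first exact: ltW.
  rewrite GS//; have [_ _ /(_ k kl ak)[_ hl _]] := stG l.
  apply: le_trans (hl (n i) _); first by apply: (fund_le hr); lia.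
  by apply: n_mono; lia.
Qed.

End Construction.

(** * Density of universal vectors and dense universal subspaces *)

Section Generic.
Context {R : realType} {K : numFieldType} (S : scalars R K) (E Y : lmodType K).
Context (q : nat -> E -> R) (hq : fundamental S q) (cq : scomplete q).
Context (r : nat -> Y -> R) (hr : fundamental S r).
Context (Z : set Y) (Z0 : Z 0) (Zlin : forall a x y, Z x -> Z y -> Z (a *: x + y)).
Context (D : set E) (D0 : D 0) (Dlin : forall a x y, D x -> D y -> D (a *: x + y)).
Context (Ddense : forall x m (e : R), 0 < e -> exists2 h, D h & q m (x - h) < e).
Context (L : nat -> {linear E -> Y}).
Context (Ldom : forall n i, dominated S q (fun x => r i (L n x))).
Context (cL : converges_on r Z D L).
Context (zeta : nat -> Y) (Zzeta : forall l, Z (zeta l)).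
Context (zeta_dense : forall z m (e : R), Z z -> 0 < e -> exists l, r m (zeta l - z) < e).

(** The factor [5 ^ N] makes [i] large without touching the exponents of 2 and 3. *)
Lemma logn_surjective a b N : exists i, [/\ (N <= i)%N, logn 2 i = a & logn 3 i = b].
Proof.
exists (2 ^ a * 3 ^ b * 5 ^ N)%N; split.
- apply: leq_trans (ltnW (ltn_expl N (isT : 1 < 5)%N)) _.
  by rewrite leq_pmull// muln_gt0 !expn_gt0.
- rewrite !lognM ?muln_gt0 ?expn_gt0// !lognX/= (_ : logn 2 2 = 1%N)//.
  by rewrite (_ : logn 2 3 = 0%N)// (_ : logn 2 5 = 0%N)// !muln0 !addn0 muln1.
- rewrite !lognM ?muln_gt0 ?expn_gt0// !lognX/= (_ : logn 3 2 = 0%N)//.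
  by rewrite (_ : logn 3 3 = 1%N)// (_ : logn 3 5 = 0%N)// !muln0 addn0 muln1 add0n.
Qed.

(** Following [c *: zeta l] instead of [zeta l] is harmless: to reach [z], take [zeta l] within
    [e / 2 / nm S c] of [c^-1 *: z], which is again in [Z]. *)
Lemma univ_along (n : nat -> nat) x k (c : K) : c != 0 ->
  (forall m (e : R), 0 < e -> exists N, forall i, (N <= i)%N -> logn 2 i = k ->
     r m (L (n i) x - c *: zeta (logn 3 i)) < e) ->
  univ r Z L x.
Proof.
move=> c0 h z m e Zz e0; have rm := fund_sn hr m.
have e20 : 0 < e / 2 by rewrite divr_gt0.
have nc0 : 0 < nm S c by rewrite nm_gt0.
have Zcz : Z (c^-1 *: z) by rewrite -[_ *: _]addr0; exact: Zlin.
have [l hl] := zeta_dense m Zcz (divr_gt0 e20 nc0).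
have [N hN] := h m _ e20.
have [i [Ni i2 i3]] := logn_surjective k l N.
exists (n i); have := hN i Ni i2; rewrite i3 => h1.
have h2 : r m (c *: zeta l - z) < e / 2.
  have -> : c *: zeta l - z = c *: (zeta l - c^-1 *: z).
    by rewrite scalerBr scalerA divff// scale1r.
  by rewrite (snZ rm) mulrC -ltr_pdivlMr.
by have := sn_tri rm (c *: zeta l) (L (n i) x) z; lra.
Qed.

Lemma univ_dense : attainable q r Z L ->
  forall x m (e : R), 0 < e -> exists2 g, univ r Z L g & q m (x - g) < e.
Proof.
move=> aL x m e e0; have cof := attainable_cofinalP hq hr Zlin Ldom aL.
have e20 : 0 < e / 2 by rewrite divr_gt0.
have e80 : 0 < e / 8 by rewrite divr_gt0.
have [h Dh xh] := Ddense x m e20.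
(* Only vector number [m] is active: its displacement is controlled in [q m], the seminorm of the
   statement. The bound [2 * (e / 8)] stays below the remaining [e / 2]. *)
have [//|//||n [g [u [_ [u0 uS] gu tau_lim _]]]] :=
  tracks hq cq hr Z0 Zlin D0 Dlin Ddense Ldom cL (act := pred1 m)
   (tau := fun i _ => zeta (logn 3 i)) (U := fun _ _ => h) e80.
  move=> i z m' d N Zz d0; have [n [s [Nn s1 s2]]] := cof (z m) m' d N (Zz m) d0.
  by exists n; split => // k _ /eqP ->; exists s.
exists (g m).
  apply: (@univ_along n (g m) 0%N 1); first exact: oner_neq0.
  move=> m' d d0; have [N hN] := geometric_small (2 * (e / 8)) d0.
  exists (maxn N (maxn m m')) => i hi _; rewrite scale1r.
  apply: le_lt_trans (hN i _); last by lia.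
  rewrite -mulrA; apply: le_trans (tau_lim i m _ _); rewrite /= ?eqxx//; last by lia.
  by apply: (fund_le hr); lia.
have um : u m = h by case: (m) => [|k]; rewrite ?u0 ?uS.
have := gu m (eqxx m); rewrite um.
have := geometric_le (ltW e80) (leq0n m); rewrite expr0 divr1.
have := sn_tri (fund_sn hq m) h x (g m); rewrite (snC (fund_sn hq m) h (g m)); lra.
Qed.

Context (ev : attainable_eventually q r Z L).

(** Eventual attainability is what makes this possible: finitely many cofinite sets of indices meet,
    whereas infinite sets of indices might not. *)
Lemma attainable_common i (z : nat -> Y) m (e : R) N : (forall k, Z (z k)) -> 0 < e ->
  exists n, (N <= n)%N /\
    forall k, (k <= i)%N -> xpredT k -> exists s, q m s < e /\ r m (L n s - z k) < e.
Proof.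
move=> Zz e0; suff [N' hN'] : exists N', forall n, (N' <= n)%N -> forall k, (k <= i)%N ->
    exists s, q m s < e /\ r m (L n s - z k) < e.
  by exists (maxn N N'); split=> [|k ki _]; [exact: leq_maxl|apply: hN' => //; exact: leq_maxr].
elim: i => [|i [N1 IH]].
  have [N' hN'] := ev m (Zz 0%N) e0.
  by exists N' => n Nn k; rewrite leqn0 => /eqP->; exact: hN'.
have [N' hN'] := ev m (Zz i.+1) e0.
exists (maxn N1 N') => n Nn k; rewrite leq_eqVlt => /predU1P[->|]; first by apply: hN'; lia.
by rewrite ltnS; apply: IH; lia.
Qed.

(* The exponents of 2 and 3 in i tell which vector and which target are treated at
   step i; each pair of exponents occurs for arbitrarily large i. *)
Definition target i k := if k == logn 2 i then zeta (logn 3 i) else 0.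

Lemma Ztarget i k : Z (target i k).
Proof. by rewrite /target; case: ifP. Qed.

Lemma sum_target N i (c : nat -> K) : (logn 2 i < N)%N ->
  \sum_(k < N) c k *: target i k = c (logn 2 i) *: zeta (logn 3 i).
Proof.
move=> iN; rewrite (bigD1 (Ordinal iN))//= /target eqxx big1 ?addr0// => k.
by rewrite -val_eqE/= => /negPf ->; rewrite scaler0.
Qed.

Lemma dense_subspace (b : nat -> E) : (forall j, D (b j)) ->
  D `<=` fspan b ->
  exists M : set E,
    [/\ M 0, forall a x y, M x -> M y -> M (a *: x + y),
        forall x m (e : R), 0 < e -> exists2 y, M y & q m (x - y) < e &
        forall x, M x -> x != 0 -> univ r Z L x].
Proof.
move=> Db Dspan.
have [|n [g [u [_ [u0 uS] gu tau_lim _]]]] :=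
  tracks hq cq hr Z0 Zlin D0 Dlin Ddense Ldom cL (act := xpredT)
   (tau := target) (U := fun k _ => b (logn 2 k)) ltr01 (fun k _ => Db (logn 2 k)) Ztarget.
  exact: attainable_common.
have {u0 uS}uE k : u k = b (logn 2 k) by case: k => [|k]; rewrite ?u0 ?uS.
have Mb j m e : 0 < e -> exists2 y, fspan g y & q m (b j - y) < e.
  move=> e0; have [N hN] := geometric_small (2 * 1) e0.
  have [k [Nk k2 _]] := logn_surjective j 0%N (maxn N m).
  exists (g k); first exact: fspan_mem.
  rewrite (snC (fund_sn hq m)) -k2 -uE.
  apply: le_lt_trans (hN k _); last by lia.
  rewrite -mulrA; apply: le_trans (gu k isT); apply: (fund_le hq); lia.
exists (fspan g); split.
- exact: fspan0.
- exact: fspan_linear.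
- move=> x m e e0; have e20 : 0 < e / 2 by rewrite divr_gt0.
  have [h Dh xh] := Ddense x m e20; have qm := fund_sn hq m.
  suff [y My hy] : exists2 y, fspan g y & q m (h - y) < e / 2.
    by exists y => //; have := sn_tri qm h x y; lra.
  have [N [c ->]] := Dspan _ Dh => {h Dh xh}.
  elim: N {e e0} (e / 2) e20 => [|N IH] e e0.
    by exists 0; first exact: fspan0; rewrite big_ord0 subr0 (sn0 qm).
  have e20 : 0 < e / 2 by rewrite divr_gt0.
  have [y My hy] := IH _ e20.
  have nc0 : 0 < nm S (c N) + 1 by have := nm_ge0 S (c N); lra.
  have [y' My' hy'] := Mb N m _ (divr_gt0 e20 nc0).
  exists (c N *: y' + y); first exact: fspan_linear.
  rewrite big_ord_recr/= [c N *: y' + y]addrC opprD addrACA -scalerBr.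
  apply: le_lt_trans (snD qm _ _) _; rewrite (snZ qm).
  move: hy'; rewrite ltr_pdivlMr// mulrDr mulr1 mulrC.
  by have := sn_ge0 qm (b N - y'); lra.
- move=> _ [N [c ->]] x0.
  have [k0 c0] : exists k : 'I_N, c k != 0.
    apply: contrapT => /forallNP h; move/negP: x0; apply; apply/eqP.
    by rewrite big1// => k _; have /negP/negPn/eqP -> := h k; rewrite scale0r.
  apply: (@univ_along n _ k0 (c k0)) => // m e e0.
  have rS := fund_sn hr; pose C := \sum_(k < N) nm S (c k).
  have [N' hN'] := geometric_small (C * (2 * 1)) e0.
  exists (maxn N (maxn N' m)) => i hi i2.
  (* At the steps devoted to vector [k0] the other targets are 0, so the target of the combination
     is [c k0 *: zeta (logn 3 i)]. Taking [i >= N] ensures that all vectors involved are under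
     control. *)
  have -> : L (n i) (\sum_(k < N) c k *: g k) - c k0 *: zeta (logn 3 i) =
      \sum_(k < N) c k *: (L (n i) (g k) - target i k).
    rewrite linear_sum -i2 -(sum_target (N := N)) ?i2// -sumrB.
    by apply: eq_bigr => k _; rewrite linearZ scalerBr.
  apply: le_lt_trans (hN' i _); last by lia.
  apply: le_trans (sn_sum (rS m) _ _ _) _; rewrite /C -mulrA mulr_suml.
  apply: ler_sum => k _; rewrite (snZ (rS m)) ler_wpM2l ?nm_ge0//.
  rewrite -mulrA; apply: le_trans (tau_lim i k isT _); last by have := ltn_ord k; lia.
  by apply: (fund_le hr); lia.
Qed.

End Generic.

(** * Closed spans of perturbed basic sequences *)

Section ClosedSpan.
Context {R : realType} {K : numFieldType} (S : scalars R K) (E Y : lmodType K).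
Context (q : nat -> E -> R) (hq : fundamental S q) (cq : scomplete q).
Context (r : nat -> Y -> R) (hr : fundamental S r).
Context (Z : set Y) (Z0 : Z 0) (Zlin : forall a x y, Z x -> Z y -> Z (a *: x + y)).
Context (D : set E) (D0 : D 0) (Dlin : forall a x y, D x -> D y -> D (a *: x + y)).
Context (Ddense : forall x m (e : R), 0 < e -> exists2 h, D h & q m (x - h) < e).
Context (L : nat -> {linear E -> Y}).
Context (Ldom : forall n i, dominated S q (fun x => r i (L n x))).
Context (cL : converges_on r Z D L).
Context (zeta : nat -> Y) (Zzeta : forall l, Z (zeta l)).
Context (zeta_dense : forall z m (e : R), Z z -> 0 < e -> exists l, r m (zeta l - z) < e).

(** Step [i] controls [i + 1] vectors with an error of order [2^-i] each. The sum tends to 0 because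
    [(i + 1)^2 <= 4 * 2^i]. *)
Lemma linear_geometric_small (C e : R) : 0 < e ->
  exists N, forall i, (N <= i)%N -> C * i.+1%:R / 2 ^+ i < e.
Proof.
move=> e0; pose M := 4 * `|C| / e; have M0 : 0 <= M by rewrite divr_ge0 ?(ltW e0)// mulr_ge0.
exists (Num.bound M) => i hi.
have i10 : 0 < i.+1%:R :> R by rewrite ltr0n.
have sq : i.+1%:R * i.+1%:R <= 4 * 2 ^+ i :> R.
  rewrite -natrX -!natrM ler_nat; elim: i {hi i10} => [//|[|[|i]] IH]//.
  by rewrite expnS; nia.
have Mi : M < i.+1%:R by apply: lt_le_trans (archi_boundP M0) _; rewrite ler_nat ltnW.
rewrite ltr_pdivrMr ?exprn_gt0//.
apply: le_lt_trans (ler_norm _) _; rewrite normrM (ger0_norm (ltW i10)).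
move: Mi; rewrite /M ltr_pdivrMr// => Mi.
rewrite -(ltr_pM2l (_ : 0 < 4 :> R))//.
have : 4 * `|C| * i.+1%:R < i.+1%:R * e * i.+1%:R by rewrite ltr_pM2r.
have : e * (i.+1%:R * i.+1%:R) <= e * (4 * 2 ^+ i) by rewrite ler_wpM2l// ltW.
rewrite !mulrA [_ * e]mulrC; lra.
Qed.

Context (q_norm : forall x, q 0 x = 0 -> x = 0).
Context (v : nat -> E) (Dv : forall j, D (v j)) (v1 : forall j, q 0 (v j) = 1).
Context (v_basic : forall m i i' (c : nat -> K), (m <= i)%N -> (i <= i')%N ->
  q m (\sum_(k < i) c k *: v k) <= 2 * q m (\sum_(k < i') c k *: v k)).
(** [L n] reads only coordinates up to [rank n], and acts as [J] on vectors where these vanish. [J]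
    will be 0 for generalized universal series and [g |-> (0, g)] for restricted ones. *)
Context (rank : nat -> nat) (rank_mono : forall i, (rank i < rank i.+1)%N).
Context (J : {linear E -> Y}) (Jdom : forall i, dominated S q (fun x => r i (J x))).
Context (L_tail : forall n j, (rank n < j)%N -> L n (v j) = J (v j)).
Context (ev : attainable_eventually q r Z L).

(** Filling the gaps with zero coefficients turns a cut at [i] into a cut at [j i], and
    [m <= i <= j i] keeps the inequality for [q m] available. *)
Lemma basic_subsequence (j : nat -> nat) : {homo j : m n / (m < n)%N} ->
  forall m i i' (c : nat -> K), (m <= i)%N -> (i <= i')%N ->
  q m (\sum_(k < i) c k *: v (j k)) <= 2 * q m (\sum_(k < i') c k *: v (j k)).
Proof.
move=> jS m i i' c mi ii'; have jge k : (k <= j k)%N.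
  by elim: k => // k IH; apply: leq_ltn_trans IH (jS _ _ (ltnSn k)).
have jlt k l : (j k < j l)%N = (k < l)%N by apply: leqW_mono; apply: leq_mono.
(* A sum over a fibre with at most one element, which avoids inverting [j]. *)
pose c' l := \sum_(k < i' | j k == l) c k.
have cE t : (t <= i')%N -> \sum_(k < t) c k *: v (j k) = \sum_(l < j t) c' l *: v l.
  move=> ti'; rewrite (big_ord_widen _ (fun k => c k *: v (j k)) ti').
  under [RHS]eq_bigr do rewrite /c' scaler_suml.
  rewrite (exchange_big_dep (fun k : 'I_i' => (k < t)%N))/=; last first.
    by move=> l k _ /eqP jl; rewrite -jlt jl.
  apply: eq_bigr => k kt; have jkt : (j k < j t)%N by rewrite jlt.
  rewrite (bigD1 (Ordinal jkt))//= big1 ?addr0// => l /andP[/eqP jl].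
  by rewrite -val_eqE/= -jl eqxx.
rewrite !cE//; apply: v_basic; first exact: leq_trans mi (jge i).
by move: ii'; rewrite leq_eqVlt => /predU1P[->//|]; rewrite -jlt => /ltnW.
Qed.

(** * The closed span of a perturbed basic sequence *)

Section Span.
Context (n : nat -> nat) (g u : nat -> E).
Context (u1 : forall k, q 0 (u k) = 1) (e0 : R) (e00 : 0 < e0) (e01 : e0 <= 1 / 32).
Context (u_basic : forall m i i' (c : nat -> K), (m <= i)%N -> (i <= i')%N ->
  q m (\sum_(k < i) c k *: u k) <= 2 * q m (\sum_(k < i') c k *: u k)).
Context (gu : forall k, q k (g k - u k) <= 2 * (e0 / 2 ^+ k)).

Notation psum c w N := (\sum_(k < N) c k *: w k).

(** [c k *: u k] is a difference of two consecutive partial sums, each at most twice the full sum in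
    [q 0]. *)
Lemma psum_coef (c : nat -> K) N k : (k < N)%N -> nm S (c k) <= 4 * q 0 (psum c u N).
Proof.
move=> kN; have q0 := fund_sn hq 0.
have -> : nm S (c k) = q 0 (c k *: u k) by rewrite (snZ q0) u1 mulr1.
have -> : c k *: u k = psum c u k.+1 - psum c u k by rewrite big_ord_recr/= addrC addrK.
have := snB q0 (psum c u k.+1) (psum c u k).
have := u_basic c (leq0n k.+1) kN; have := u_basic c (leq0n k) (ltnW kN); lra.
Qed.

Lemma geometric_tail (C : R) (w : nat -> R) i N : 0 <= C ->
  (forall k, (i <= k)%N -> w k <= C * (2 * (e0 / 2 ^+ k))) ->
  \sum_(i <= k < N) w k <= C * (4 * (e0 / 2 ^+ i)).
Proof.
move=> C0 hw; apply: (@le_trans _ _ (\sum_(i <= k < N) C * (2 * (e0 / 2 ^+ k)))).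
  by rewrite !big_nat; apply: ler_sum => k /andP[ik _]; exact: hw.
rewrite -mulr_sumr ler_wpM2l// -mulr_sumr.
by have := geometric_sum_le i N (ltW e00); lra.
Qed.

Lemma perturbation_tail m (c : nat -> K) C i N : 0 <= C -> (m <= i)%N ->
  (forall k, (i <= k)%N -> (k < N)%N -> nm S (c k) <= C) ->
  q m (\sum_(i <= k < N) c k *: (g k - u k)) <= C * (4 * (e0 / 2 ^+ i)).
Proof.
move=> C0 mi cC; have qm := fund_sn hq m.
apply: le_trans (sn_sum qm _ _ _) _.
pose w k := if (k < N)%N then q m (c k *: (g k - u k)) else 0.
rewrite (_ : \sum_(i <= k < N) _ = \sum_(i <= k < N) w k).
  apply: geometric_tail => // k ik; rewrite /w; case: ifP => kN; last first.
    by rewrite mulr_ge0// mulr_ge0// ltW// geometric_gt0.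
  rewrite (snZ qm) ler_pM ?nm_ge0 ?(sn_ge0 qm) ?cC//.
  by apply: le_trans (gu k); apply: (fund_le hq); lia.
by rewrite !big_nat; apply: eq_bigr => k /andP[_ kN]; rewrite /w kN.
Qed.

Lemma psum_perturbation (c : nat -> K) N :
  psum c g N = psum c u N + \sum_(k < N) c k *: (g k - u k).
Proof. by rewrite -big_split/=; apply: eq_bigr => k _; rewrite -scalerDr addrC subrK. Qed.

(** Coefficients are at most 4 times the sum and the perturbations add up to at most [4 * e0]. With
    [e0 <= 1 / 32] the total change is at most half the sum and is absorbed on the left. *)
Lemma psum_u_le (c : nat -> K) N : q 0 (psum c u N) <= 2 * q 0 (psum c g N).
Proof.
have q0 := fund_sn hq 0; pose C := 4 * q 0 (psum c u N).
have C0 : 0 <= C by rewrite mulr_ge0// (sn_ge0 q0).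
have := @perturbation_tail 0%N c C 0%N N C0 isT (fun k _ => @psum_coef c N k).
rewrite big_mkord expr0 divr1 => h.
have := sn_sub q0 (psum c u N) (psum c g N).
rewrite (snC q0 (psum c u N)) psum_perturbation addrAC subrr add0r.
have : C * (4 * e0) <= C * (1 / 8) by rewrite ler_wpM2l//; have := e01; lra.
rewrite /C in h *; lra.
Qed.

Lemma psum_coef_g (c : nat -> K) N k : (k < N)%N -> nm S (c k) <= 8 * q 0 (psum c g N).
Proof. by move=> kN; have := psum_coef c kN; have := psum_u_le c N; lra. Qed.

(** In [q m] the first [m] perturbations need not be small, so no absolute constant is available;
    they are finitely many and enter [B] through [W], while the coefficients are bounded through
    [q 0 <= q m]. *)
Lemma psum_g_basic m : exists2 B, 0 <= B & forall i i' (c : nat -> K),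
  (m <= i)%N -> (i <= i')%N -> q m (psum c g i) <= B * q m (psum c g i').
Proof.
have qm := fund_sn hq m.
pose W := \sum_(k < m) q m (g k - u k) + 4 * (e0 / 2 ^+ m).
have W0 : 0 <= W.
  rewrite addr_ge0 ?sumr_ge0// => [k _|]; first exact: (sn_ge0 qm).
  by rewrite mulr_ge0// ltW// geometric_gt0.
exists (2 + 24 * W) => [|i i' c mi ii']; first by lra.
pose C := 8 * q 0 (psum c g i').
have C0 : 0 <= C by rewrite mulr_ge0// (sn_ge0 (fund_sn hq 0)).
have hW N : (m <= N)%N -> (N <= i')%N -> q m (\sum_(k < N) c k *: (g k - u k)) <= C * W.
  move=> mN Ni'; have cC k : (k < N)%N -> nm S (c k) <= C.
    by move=> kN; apply: psum_coef_g; exact: leq_trans Ni'.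
  rewrite -(big_mkord xpredT (fun k => c k *: (g k - u k))) (big_cat_nat (n := m))//=.
  rewrite mulrDr; apply: le_trans (snD qm _ _) (lerD _ _); last first.
    by apply: perturbation_tail => // k _; exact: cC.
  apply: le_trans (sn_sum qm _ _ _) _; rewrite big_mkord mulr_sumr.
  apply: ler_sum => k _; rewrite (snZ qm) ler_wpM2r ?(sn_ge0 qm)// cC//.
  exact: leq_trans (ltn_ord k) mN.
have hi := hW i mi ii'; have hi' := hW i' (leq_trans mi ii') (leqnn _).
have := snD qm (psum c u i) (\sum_(k < i) c k *: (g k - u k)).
rewrite -psum_perturbation => h1.
have := snB qm (psum c g i') (\sum_(k < i') c k *: (g k - u k)).
rewrite psum_perturbation addrK -psum_perturbation => h2.
have h3 := u_basic c mi ii'.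
have : C * W <= 8 * q m (psum c g i') * W.
  by rewrite ler_wpM2r// /C ler_wpM2l// (fund_le hq).
move: (q m _) h1 h2 h3 hi hi' => X; lra.
Qed.

Definition cspan := [set x | forall m (e : R), 0 < e ->
  exists2 y, fspan g y & q m (x - y) < e].

Lemma cspan_fspan x : fspan g x -> cspan x.
Proof. by move=> gx m e e1; exists x; rewrite // subrr (sn0 (fund_sn hq m)). Qed.

Lemma cspan_linear a x y : cspan x -> cspan y -> cspan (a *: x + y).
Proof.
move=> Mx My m e e1; have e20 : 0 < e / 2 by rewrite divr_gt0.
have qm := fund_sn hq m.
have na0 : 0 < nm S a + 1 by have := nm_ge0 S a; lra.
have [x' gx' hx] := Mx m _ (divr_gt0 e20 na0); have [y' gy' hy] := My m _ e20.
exists (a *: x' + y'); first exact: fspan_linear.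
rewrite opprD addrACA -scalerBr.
apply: le_lt_trans (snD qm _ _) _; rewrite (snZ qm).
move: hx; rewrite ltr_pdivlMr// mulrDr mulr1 mulrC.
by have := sn_ge0 qm (x - x'); lra.
Qed.

Lemma cspan_closed x :
  (forall m (e : R), 0 < e -> exists2 y, cspan y & q m (x - y) < e) -> cspan x.
Proof.
move=> h m e e1; have e20 : 0 < e / 2 by rewrite divr_gt0.
have [y My xy] := h m _ e20; have [z gz yz] := My m _ e20.
by exists z => //; have := sn_tri (fund_sn hq m) y x z; lra.
Qed.

Lemma g_free N (c : nat -> K) : psum c g N = 0 -> forall k, (k < N)%N -> c k = 0.
Proof.
move=> h k kN; have := psum_coef_g c kN; rewrite h (sn0 (fund_sn hq 0)) mulr0.
by move=> c0; apply/eqP; rewrite -(nm_eq0 S) eq_le c0 nm_ge0.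
Qed.

(** Finite sums [f a] tending to [x] have coefficients that are Cauchy for each k, by [psum_coef_g];
    their limits are [c]. The basis inequality bounds the partial sums of [C a - c] uniformly in
    their length, so the partial sums of [c] inherit the limit [x]. *)
Lemma cspan_expansion x : cspan x -> exists c : nat -> K, scvg q (fun N => psum c g N) x.
Proof.
move=> Mx.
have /choice[F FP] : forall a, exists F : nat * (nat -> K),
    (forall k, (F.1 <= k)%N -> F.2 k = 0) /\ q a (x - psum F.2 g F.1) < 1 / 2 ^+ a.
  move=> a; have [_ [N [c ->]] hc] := Mx a _ (geometric_gt0 a ltr01).
  (* With coefficients extended by 0, approximations of different lengths can be compared at any
     common larger length. *)
  exists (N, fun k => if (k < N)%N then c k else 0); split => /= [k|].
    by rewrite leqNgt => /negPf ->.
  by rewrite -(sum_pad _ _ (leqnn N)).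
pose N a := (F a).1; pose C a := (F a).2; pose f a := psum (C a) g (N a).
have fE a i : (N a <= i)%N -> psum (C a) g i = f a.
  move=> ai; rewrite /f (sum_pad _ _ ai); apply: eq_bigr => k _.
  by case: ltnP => // /(FP a).1; rewrite -/(C a) => ->.
have xf m a : (m <= a)%N -> q m (x - f a) < 1 / 2 ^+ a.
  by move=> ma; apply: le_lt_trans (FP a).2; apply: (fund_le hq).
have ff m a b : (m <= a)%N -> (a <= b)%N -> q m (f a - f b) <= 2 / 2 ^+ a.
  move=> ma ab; have := sn_tri (fund_sn hq m) x (f a) (f b).
  rewrite (snC (fund_sn hq m) (f a) x).
  have := xf m a ma; have := xf m b (leq_trans ma ab).
  by have := geometric_le (@ler01 R) ab; lra.
have psumB a b i : psum (fun k => C a k - C b k) g i = psum (C a) g i - psum (C b) g i.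
  by rewrite -sumrB; apply: eq_bigr => k _; rewrite scalerBl.
have coef a b k : (a <= b)%N -> nm S (C a k - C b k) <= 16 / 2 ^+ a.
  move=> ab; pose i := maxn k.+1 (maxn (N a) (N b)).
  have ki : (k < i)%N by rewrite /i; lia.
  apply: le_trans (psum_coef_g (fun k => C a k - C b k) ki) _.
  by rewrite psumB !fE /i; [have := ff 0%N a b isT ab; lra|lia|lia].
have /choice[c cP] : forall k, exists l, forall e : R, 0 < e -> exists M, forall a,
    (M <= a)%N -> nm S (C a k - l) < e.
  move=> k; apply: (@scalar_complete _ _ S (fun a => C a k)) => e e1.
  have [M hM] := geometric_small 16 e1; exists M => a b Ma Mb.
  wlog ab : a b Ma Mb / (a <= b)%N => [hw|]; last first.
    by apply: le_lt_trans (coef a b k ab) _; exact: hM.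
  have [/hw|/ltnW /hw] := leqP a b; first exact.
  by rewrite -nmN opprB; exact.
have lim m i e : 0 < e -> exists M, forall b, (M <= b)%N ->
    q m (psum (fun k => C b k - c k) g i) < e.
  have qm := fund_sn hq m.
  elim: i e => [|i IH] e e1; first by exists 0%N => b _; rewrite big_ord0 (sn0 qm).
  have e20 : 0 < e / 2 by rewrite divr_gt0.
  have [M hM] := IH _ e20.
  have g0 : 0 < q m (g i) + 1 by have := sn_ge0 qm (g i); lra.
  have [M' hM'] := cP i _ (divr_gt0 e20 g0); exists (maxn M M') => b hb.
  rewrite big_ord_recr/=; apply: le_lt_trans (snD qm _ _) _; rewrite (snZ qm).
  have := hM b ltac:(lia); have := hM' b ltac:(lia).
  rewrite ltr_pdivlMr// mulrDr mulr1; have := nm_ge0 S (C b i - c i); lra.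
exists c => m e e1; have qm := fund_sn hq m; have [B B0 hB] := psum_g_basic m.
(* [C a - c] is compared with [C a - C b] for large [b]: the basis inequality bounds partial sums of
   the latter by [f a - f b], and the rest vanishes as [b] grows with [i] fixed. *)
have tail a i : (m <= a)%N -> (m <= i)%N ->
    q m (psum (fun k => C a k - c k) g i) <= B * (2 / 2 ^+ a).
  move=> ma mi; apply/ler_addgt0Pl => d d0; have [M hM] := lim m i d d0.
  pose b := maxn M a; pose i' := maxn i (maxn (N a) (N b)).
  have : q m (psum (fun k => C a k - C b k) g i) <= B * (2 / 2 ^+ a).
    have ii' : (i <= i')%N := leq_maxl _ _.
    apply: le_trans (hB i i' (fun k => C a k - C b k) mi ii') _.
    rewrite ler_wpM2l// psumB !fE /i'; [|lia|lia].
    by apply: ff => //; rewrite /b; lia.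
  have := hM b (leq_maxl _ _).
  have -> : psum (fun k => C a k - c k) g i =
     psum (fun k => C b k - c k) g i + psum (fun k => C a k - C b k) g i.
    rewrite -big_split/=; apply: eq_bigr => k _.
    by rewrite -scalerDl; congr (_ *: _); ring.
  by have := snD qm (psum (fun k => C b k - c k) g i) (psum (fun k => C a k - C b k) g i); lra.
have [M hM] := geometric_small (1 + B * 2) e1.
pose a := maxn m M; exists (maxn m (N a)) => i hi.
rewrite (snC qm); apply: le_lt_trans (hM a (leq_maxr _ _)).
have := xf m a (leq_maxl _ _); have := tail a i (leq_maxl _ _) ltac:(lia).
have -> : psum (fun k => C a k - c k) g i = f a - psum c g i.
  rewrite -(fE a i ltac:(lia)) -sumrB; apply: eq_bigr => k _.
  by rewrite scalerBl.
have -> : (1 + B * 2) / 2 ^+ a = 1 / 2 ^+ a + B * (2 / 2 ^+ a) by ring.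
have := sn_tri qm (f a) x (psum c g i); lra.
Qed.

Context (tau_lim : forall i k, (k <= i)%N ->
  r i (L (n i) (g k) - target zeta i k) <= 2 * (e0 / 2 ^+ i)).
Context (L_later : forall i k, (i < k)%N -> r i (L (n i) (g k - u k)) <= 2 * (e0 / 2 ^+ k)).
Context (Lu : forall i k, (i < k)%N -> L (n i) (u k) = J (u k)).

Lemma cspan_univ x : cspan x -> x != 0 -> univ r Z L x.
Proof.
move=> Mx x0; have [c cx] := cspan_expansion Mx.
have [k0 ck0] : exists k, c k != 0.
  apply: contrapT => /forallNP h; move/negP: x0; apply; apply/eqP/q_norm.
  apply/eqP; rewrite eq_le (sn_ge0 (fund_sn hq 0)) andbT.
  apply/ler_addgt0Pl => e e1; have [N hN] := cx 0%N e e1; have := hN N (leqnn N).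
  rewrite big1 => [|k _]; last by have /negP/negPn/eqP -> := h k; rewrite scale0r.
  by rewrite sub0r (snN (fund_sn hq 0)) addr0 => /ltW.
(* Partial sums eventually lie within 1 of [x] in [q 0]; this bounds all coefficients at once. *)
pose C := 8 * (q 0 x + 1).
have C0 : 0 <= C by have := sn_ge0 (fund_sn hq 0) x; rewrite /C; lra.
have cC k : nm S (c k) <= C.
  have [N hN] := cx 0%N 1 ltr01.
  apply: le_trans (@psum_coef_g c (maxn k.+1 N) k (leq_maxl _ _)) _.
  rewrite ler_wpM2l//; have := hN _ (leq_maxr k.+1 N).
  have := sn_sub (fund_sn hq 0) (psum c g (maxn k.+1 N)) x; lra.
clearbody C; apply: (univ_along hr Z0 Zlin zeta_dense (n := n) (k := k0) ck0) => m e e1.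
have rm := fund_sn hr m.
have e60 : 0 < e / 6 by rewrite divr_gt0.
have [N1 hN1] := linear_geometric_small (C * (2 * e0)) e60.
have [N2 hN2] := geometric_small (C * (4 * e0)) e60.
have [lJ [CJ [CJ0 hJ]]] := (Jdom m).2.
(* Three errors of this size occur in [A3]: two tails of the expansion and one perturbation. *)
have eJ : 0 < e / 6 / CJ / 4 by rewrite !divr_gt0.
have [N3 hN3] := cx lJ _ eJ.
have [N4 hN4] := geometric_small (C * (4 * e0)) eJ.
exists (maxn (maxn m lJ) (maxn (maxn N1 N2) (maxn (maxn N3 N4) k0))) => i.
rewrite !geq_max => /andP[/andP[mi lJi] /andP[/andP[N1i N2i] /andP[/andP[N3i N4i] k0i]]] ik0.
(* With [i] fixed, continuity of [L (n i)] lets the expansion be truncated at a length [T] depending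
   on [i]. *)
have [T0 hT0] := scvg_dominated (Ldom (n i) m) cx e60.
pose T := maxn T0 i.+1; have iT : (i.+1 <= T)%N := leq_maxr _ _.
have hT := hT0 T (leq_maxl _ _); rewrite linearB/= in hT.
(* L_(n i) (sum c_k g_k) - c_k0 zeta splits into the vectors already treated at
   step i, the later corrections, and the tail of sum c_k u_k seen through J. *)
pose A1 := \sum_(k < i.+1) c k *: (L (n i) (g k) - target zeta i k).
pose A2 := \sum_(i.+1 <= k < T) c k *: L (n i) (g k - u k).
pose A3 := \sum_(i.+1 <= k < T) c k *: u k.
have LE : L (n i) (psum c g T) - c k0 *: zeta (logn 3 i) = A1 + A2 + J A3.
  have -> : c k0 *: zeta (logn 3 i) = \sum_(k < i.+1) c k *: target zeta i k.
    by rewrite sum_target ik0.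
  rewrite -(big_mkord xpredT (fun k => c k *: g k)) (big_cat_nat (n := i.+1))//=.
  rewrite big_mkord linearD/= addrAC -[RHS]addrA; congr (_ + _).
    rewrite linear_sum -sumrB; apply: eq_bigr => k _.
    by rewrite linearZ/= scalerBr.
  rewrite /A2 /A3 !linear_sum -big_split/= !big_nat; apply: eq_bigr => k /andP[ik _].
  by rewrite !linearZ/= -(Lu ik) -scalerDr -linearD subrK.
have bA1 : r m A1 < e / 6.
  apply: le_lt_trans (hN1 i N1i).
  apply: le_trans (sn_sum rm _ _ _) _.
  apply: (@le_trans _ _ (\sum_(k < i.+1) C * (2 * (e0 / 2 ^+ i)))).
    apply: ler_sum => k _; rewrite (snZ rm) ler_pM ?nm_ge0 ?(sn_ge0 rm)//.
    apply: le_trans (tau_lim _); last by rewrite -ltnS.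
    exact: (fund_le hr).
  by rewrite sumr_const card_ord -mulr_natr le_eqVlt; apply/orP; left; apply/eqP; ring.
have bA2 : r m A2 < e / 6.
  apply: le_lt_trans (hN2 i.+1 (leqW N2i)).
  apply: le_trans (sn_sum rm _ _ _) _; rewrite -!mulrA.
  pose w k := if (i < k)%N then r m (c k *: L (n i) (g k - u k)) else 0.
  rewrite (_ : \sum_(i.+1 <= k < T) _ = \sum_(i.+1 <= k < T) w k).
    apply: geometric_tail => // k ik; rewrite /w ik (snZ rm).
    rewrite ler_pM ?nm_ge0 ?(sn_ge0 rm)//; apply: le_trans (L_later ik).
    exact: (fund_le hr).
  by rewrite !big_nat; apply: eq_bigr => k /andP[ik _]; rewrite /w ik.
have bA3 : r m (J A3) < e / 6.
  apply: le_lt_trans (hJ _) _; have qJ := fund_sn hq lJ.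
  rewrite mulrC -ltr_pdivlMr//.
  have -> : A3 = (psum c g T - psum c g i.+1) - \sum_(i.+1 <= k < T) c k *: (g k - u k).
    rewrite -(big_mkord xpredT (fun k => c k *: g k)) (big_cat_nat (n := i.+1))//=.
    rewrite big_mkord [X in X - _]addrAC subrr add0r /A3 -sumrB; apply: eq_bigr => k _.
    by rewrite -scalerBr subKr.
  have h1 := hN3 T (leq_trans (leqW N3i) iT); have h2 := hN3 i.+1 (leqW N3i).
  have h3 := @perturbation_tail lJ c C i.+1 T C0 (leqW lJi) (fun k _ _ => cC k).
  have h4 := hN4 i.+1 (leqW N4i).
  have := snB qJ (psum c g T - psum c g i.+1) (\sum_(i.+1 <= k < T) c k *: (g k - u k)).
  have := sn_tri qJ x (psum c g T) (psum c g i.+1); rewrite (snC qJ x).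
  have : C * (4 * (e0 / 2 ^+ i.+1)) = C * (4 * e0) / 2 ^+ i.+1 by ring.
  lra.
have := sn_tri rm (L (n i) (psum c g T)) (L (n i) x) (c k0 *: zeta (logn 3 i)).
rewrite (snC rm (L (n i) x) (L (n i) (psum c g T))) LE.
have := snD rm (A1 + A2) (J A3); have := snD rm A1 A2; lra.
Qed.

End Span.

Lemma spaceable_subspace : exists (M : set E) (g : nat -> E),
  [/\ M 0, forall a x y, M x -> M y -> M (a *: x + y),
      forall x, (forall m (e : R), 0 < e -> exists2 y, M y & q m (x - y) < e) -> M x,
      (forall k, M (g k)) /\ (forall N (c : nat -> K), \sum_(k < N) c k *: g k = 0 ->
         forall k, (k < N)%N -> c k = 0) &
      forall x, M x -> x != 0 -> univ r Z L x].
Proof.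
(* [(rank n).+1] is the first position in [v] from which [L n] acts as [J]; since indices and ranks
   increase, the same holds for all earlier maps. *)
pose U k n := v (if k is 0 then 0 else (rank n).+1)%N.
have e00 : 0 < 1 / 32 :> R by lra.
have [|n [g [u [nS [u0 uS] gu tau_lim L_later]]]] :=
  tracks hq cq hr Z0 Zlin D0 Dlin Ddense Ldom cL (act := xpredT)
   (tau := target zeta) (U := U) e00 (fun k _ => Dv _) (Ztarget Z0 Zzeta).
  move=> i z m e N; exact: (attainable_common (q := q) (r := r)).
pose j k := if k is k'.+1 then (rank (n k')).+1 else 0%N.
have uE k : u k = v (j k) by case: k => [|k]; rewrite ?u0 ?uS.
have rankS : {homo rank : m n / (m < n)%N} by apply: homo_ltn => // ? ? ?; exact: ltn_trans.
have nSS : {homo n : m n / (m < n)%N} by apply: homo_ltn => // ? ? ?; exact: ltn_trans.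
have jS : {homo j : m n / (m < n)%N}.
  by apply: homo_ltn => [? ? ?|[|k]//=]; [exact: ltn_trans|rewrite ltnS; exact/rankS/nSS].
have u1 k : q 0 (u k) = 1 by rewrite uE.
have ub m i i' (c : nat -> K) : (m <= i)%N -> (i <= i')%N ->
    q m (\sum_(k < i) c k *: u k) <= 2 * q m (\sum_(k < i') c k *: u k).
  move=> mi ii'; have := basic_subsequence jS c mi ii'.
  by under eq_bigr do rewrite -uE; under [in X in _ <= X -> _]eq_bigr do rewrite -uE.
have gu' k := gu k isT.
have Lu i k : (i < k)%N -> L (n i) (u k) = J (u k).
  case: k => // k ik; rewrite uE; apply: L_tail => /=; rewrite ltnS.
  move: ik; rewrite ltnS leq_eqVlt => /predU1P[->//|ik]; exact/ltnW/rankS/nSS.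
exists (cspan g), g; split.
- exact/cspan_fspan/fspan0.
- exact: cspan_linear.
- exact: cspan_closed.
- split=> [k|N c]; first exact/cspan_fspan/fspan_mem.
  exact: (g_free u1 e00 (lexx _) ub gu').
- move=> x; apply: (cspan_univ u1 e00 (lexx _) ub gu') => // i k ik.
  - exact: tau_lim.
  - exact: L_later.
  - exact: Lu.
Qed.

End ClosedSpan.

(** * Mazur's construction of basic sequences *)

(** More vectors than linear conditions. It yields both the next basic vector and the infinite
    dimension of the span. *)
Lemma kernel_vector (K : fieldType) (n : nat) (a : 'I_n.+1 -> 'I_n -> K) :
  exists2 c : 'I_n.+1 -> K, exists j, c j != 0 & forall t, \sum_j c j * a j t = 0.
Proof.
pose M := \matrix_(i, j) a i j.
have : kermx M != 0.
  by rewrite -mxrank_eq0 mxrank_ker subn_eq0 -ltnNge ltnS rank_leq_col.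
move=> /rowV0Pn[c /sub_kermxP cM c0].
exists (fun j => c 0 j) => [|t].
  by move/rV0Pn: c0 => [j cj]; exists j.
have := congr1 (fun A : 'rV_n => A 0 t) cM; rewrite !mxE => h; rewrite -[RHS]h.
by apply: eq_bigr => j _; rewrite !mxE.
Qed.

Section Mazur.
Context {R : realType} {K : numFieldType} (S : scalars R K) (E : lmodType K).

(* The functionals norm the points of a finite net of the unit sphere of the span;
   a vector that they all kill is almost orthogonal to this span. *)
Lemma almost_orthogonal (p : E -> R) (i : nat) (w : nat -> E) (C d : R) :
  seminorm S p -> 0 < d ->
  (forall (c : nat -> K) k, (k < i)%N -> nm S (c k) <= C * p (\sum_(k < i) c k *: w k)) ->
  exists (F : finType) (phi : F -> {linear E -> K^o}), forall u, (forall t, phi t u = 0) ->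
    forall c : nat -> K, p (\sum_(k < i) c k *: w k) <=
      (1 + d) * p (\sum_(k < i) c k *: w k + u).
Proof.
move=> hp d0 coef.
(* Chosen so that [(1 + d) * (1 - 2 * eta) = 1]. One [eta] is lost in the norm of the net point, the
   other when returning from it to the normalized vector. *)
pose eta := d / (2 * (1 + d)).
have d1 : 0 < 1 + d by lra.
have eta0 : 0 < eta by rewrite divr_gt0//; lra.
have etaE : (1 + d) * (1 - 2 * eta) = 1 by rewrite /eta; field; lra.
pose W := \sum_(k < i) p (w k) + 1.
have W0 : 0 < W.
  by rewrite ltr_pwDr// sumr_ge0// => k _; exact: (sn_ge0 hp).
have [s sP] := disc_net S C (divr_gt0 eta0 W0).
pose F : finType := {ffun 'I_i -> 'I_(size s)}.
pose y (t : F) := \sum_(k < i) nth 0 s (t k) *: w k.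
have /choice[phi phiP] : forall t : F, exists phi : {linear E -> K^o},
    (forall x, re S (phi x) <= p x) /\ re S (phi (y t)) = p (y t).
  by move=> t; have [phi h1 h2] := hahn_banach (y t) hp; exists phi.
exists F, phi => u phiu c; set x := \sum_(k < i) _.
have := sn_ge0 hp x; rewrite le_eqVlt => /orP[/eqP <-|X0].
  by rewrite mulr_ge0// ?(sn_ge0 hp)// ltW.
pose X := emb S (p x)^-1.
have nX : nm S X = (p x)^-1 by rewrite nm_emb gtr0_norm ?invr_gt0.
pose c' k := X * c k.
have xE : X *: x = \sum_(k < i) c' k *: w k.
  by rewrite scaler_sumr; apply: eq_bigr => k _; rewrite scalerA.
have pX : p (X *: x) = 1 by rewrite (snZ hp) nX mulVf// gt_eqF.
have /choice[t0 t0P] : forall k : 'I_i, exists j : 'I_(size s), nm S (c' k - nth 0 s j) < eta / W.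
  move=> k; have := coef c' k (ltn_ord k); rewrite -xE pX mulr1 => /sP[b bs hb].
  have bi : (index b s < size s)%N by rewrite index_mem.
  by exists (Ordinal bi); rewrite /= nth_index.
pose t : F := [ffun k => t0 k].
have xy : p (X *: x - y t) <= eta.
  rewrite xE /y -sumrB; apply: le_trans (sn_sum hp _ _ _) _.
  apply: (@le_trans _ _ (\sum_(k < i) eta / W * p (w k))).
    apply: ler_sum => k _; rewrite -scalerBl (snZ hp) ler_wpM2r ?(sn_ge0 hp)//.
    by rewrite ffunE ltW.
  rewrite -mulr_sumr mulrAC ler_pdivrMr// ler_pM2l// /W; lra.
(* The functional norming [y t] does not see [u], so it gives the lower bound
   [p (y t) <= p (y t + X *: u)]. *)
have := (phiP t).1 (y t + X *: u).
rewrite linearD linearZ/= phiu scaler0 addr0 (phiP t).2 => h1.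
have h2 := sn_sub hp (X *: x) (y t).
have h3 := sn_sub hp (y t + X *: u) (X *: x + X *: u).
have : p (y t + X *: u - (X *: x + X *: u)) = p (X *: x - y t).
  by rewrite opprD addrACA subrr addr0 (snC hp).
move=> h4; have h5 : 1 - 2 * eta <= p (X *: x + X *: u) by lra.
rewrite -scalerDr (snZ hp) nX in h5.
have : (1 + d) * (1 - 2 * eta) <= (1 + d) * ((p x)^-1 * p (x + u)) by rewrite ler_pM2l.
by rewrite etaE mulrCA ler_pdivlMl// mulr1.
Qed.

Context (q : nat -> E -> R) (hq : fundamental S q) (q_norm : forall x, q 0 x = 0 -> x = 0).
Context (f : nat -> E) (phi : nat -> {linear E -> K^o}).
Context (phif : forall k j, phi k (f j) = (j == k)%:R).

(* Increasing from 1 to 2: the constants b (i+1) / b i of the successive steps have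
   all their products bounded by 2. *)
Let b i : R := 2 - 1 / 2 ^+ i.

Let b_ge1 i : 1 <= b i.
Proof. by have := geometric_le (@ler01 R) (leq0n i); rewrite expr0 divr1 /b; lra. Qed.

Let b_lt2 i : b i < 2.
Proof. by have := geometric_gt0 i (@ltr01 R); rewrite /b; lra. Qed.

Let b_ltS i : b i < b i.+1.
Proof. by have := geometric_gt0 i (@ltr01 R); rewrite /b geometricS; lra. Qed.

(** The functionals of [almost_orthogonal] for [q 0], ..., [q i] form one finite family. A nonzero
    combination of [f i], [f (i + 1)], ... with one more term than functionals can be killed by all
    of them, and its coordinates below [i] vanish automatically. *)
Lemma basic_step i (w : nat -> E) :
  (forall (c : nat -> K) k, (k < i)%N -> nm S (c k) <= 4 * q 0 (\sum_(k < i) c k *: w k)) ->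
  exists v, [/\ fspan f v, q 0 v = 1, forall l, (l < i)%N -> phi l v = 0 &
    forall m (c : nat -> K) t, (m <= i)%N ->
      b i * q m (\sum_(k < i) c k *: w k) <= b i.+1 * q m (\sum_(k < i) c k *: w k + t *: v)].
Proof.
move=> coef; pose d := b i.+1 / b i - 1.
have bi0 : 0 < b i by have := b_ge1 i; lra.
have d0 : 0 < d by rewrite subr_gt0 ltr_pdivlMr// mul1r.
have [F [psi psiP]] : exists (F : finType) (psi : F -> {linear E -> K^o}),
    forall u, (forall t, psi t u = 0) -> forall m, (m < i.+1)%N -> forall c : nat -> K,
      q m (\sum_(k < i) c k *: w k) <= (1 + d) * q m (\sum_(k < i) c k *: w k + u).
  elim: (i.+1) => [|j [F [psi IH]]]; first by exists void, (fun=> phi 0%N).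
  have coefj (c : nat -> K) k : (k < i)%N -> nm S (c k) <= 4 * q j (\sum_(k < i) c k *: w k).
    move=> ki; apply: le_trans (coef c k ki) _; rewrite ler_pM2l//.
    exact: (fund_le hq).
  have [F' [psi' IH']] := almost_orthogonal (fund_sn hq j) d0 coefj.
  exists (F + F')%type, (fun t => match t with inl t => psi t | inr t => psi' t end).
  move=> u hu m; rewrite ltnS leq_eqVlt => /predU1P[->|] c.
    by apply: IH' => t; exact: (hu (inr t)).
  by apply: IH => // t; exact: (hu (inl t)).
have [c [j0 cj0] cP] := @kernel_vector K #|F| (fun j t => psi (enum_val t) (f (i + j))).
pose u := \sum_j c j *: f (i + j)%N.
have psiu t : psi t u = 0.
  rewrite -(cP (enum_rank t)) linear_sum; apply: eq_bigr => j _.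
  by rewrite linearZ/= enum_rankK.
have phiu l : phi l u = \sum_j c j * (i + j == l)%N%:R.
  by rewrite linear_sum; apply: eq_bigr => j _; rewrite linearZ/= phif.
have u0 : u != 0.
  apply: contraNneq cj0 => u0; have := phiu (i + j0)%N.
  rewrite u0 linear0 (bigD1 j0)//= eqxx mulr1 big1 ?addr0 => [<-//|j].
  by rewrite -val_eqE/= eqn_add2l => /negPf ->; rewrite mulr0.
have qu0 : 0 < q 0 u.
  rewrite lt0r (sn_ge0 (fund_sn hq 0)) andbT.
  by apply: contra u0 => /eqP /q_norm ->.
exists (emb S (q 0 u)^-1 *: u); split.
(* [fspan] counts from 0: the coefficients are shifted by [i] and padded with zeros. *)
- exists (i + #|F|.+1)%N, (fun j => emb S (q 0 u)^-1 * (if insub (j - i)%N is Some j' then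
    (if (i <= j)%N then c j' else 0) else 0)).
  rewrite big_split_ord/= [X in X + _]big1 ?add0r => [|j _]; last first.
    by case: insub => [j'|]; rewrite ?(leqNgt i) ?ltn_ord/= mulr0 scale0r.
  rewrite scaler_sumr; apply: eq_bigr => j _; rewrite addKn leq_addr scalerA.
  by rewrite insubT ?ltn_ord//= => h; congr (_ * c _ *: _); exact: val_inj.
- by rewrite (snZ (fund_sn hq 0)) nm_emb gtr0_norm ?invr_gt0// mulVf// gt_eqF.
- move=> l li; rewrite linearZ/= phiu big1 ?scaler0// => j _.
  by rewrite gtn_eqF ?mulr0//; apply: leq_trans li _; exact: leq_addr.
- move=> m c' t mi.
  have := psiP (t *: (emb S (q 0 u)^-1 *: u)) _ m _ c'.
  have -> : 1 + d = b i.+1 / b i by rewrite /d addrC subrK.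
  rewrite -mulrA mulrCA ler_pdivlMl//; apply; rewrite ?ltnS//.
  by move=> t'; rewrite !linearZ/= psiu !scaler0.
Qed.

Lemma basic_sequence : exists v : nat -> E,
  [/\ forall j, fspan f (v j), forall j, q 0 (v j) = 1,
      forall l j, (l < j)%N -> phi l (v j) = 0 &
      forall m i i' (c : nat -> K), (m <= i)%N -> (i <= i')%N ->
        q m (\sum_(k < i) c k *: v k) <= 2 * q m (\sum_(k < i') c k *: v k)].
Proof.
pose good i (w : nat -> E) v := [/\ fspan f v, q 0 v = 1, forall l, (l < i)%N -> phi l v = 0 &
    forall m (c : nat -> K) t, (m <= i)%N ->
      b i * q m (\sum_(k < i) c k *: w k) <= b i.+1 * q m (\sum_(k < i) c k *: w k + t *: v)].
pose coef i (w : nat -> E) := forall (c : nat -> K) k, (k < i)%N ->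
  nm S (c k) <= 4 * q 0 (\sum_(k < i) c k *: w k).
have /choice[next nextP] : forall p : nat * (nat -> E), exists v,
    coef p.1 p.2 -> good p.1 p.2 v.
  move=> [i w]; have [/basic_step[v hv]|nc] := pselect (coef i w); first by exists v.
  by exists 0.
pose pre := fix pre i := if i is i'.+1 then rcons (pre i') (next (i', nth 0 (pre i'))) else [::].
pose v i := next (i, nth 0 (pre i)).
have preS i : pre i.+1 = rcons (pre i) (v i) by [].
have size_pre i : size (pre i) = i by elim: i => // i IH; rewrite preS size_rcons IH.
have preE i k : (k < i)%N -> nth 0 (pre i) k = v k.
  elim: i => // i IH; rewrite preS nth_rcons size_pre ltnS leq_eqVlt => /predU1P[->|ki].
    by rewrite ltnn eqxx.
  by rewrite ki IH.
have sumE i (c : nat -> K) : \sum_(k < i) c k *: nth 0 (pre i) k = \sum_(k < i) c k *: v k.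
  by apply: eq_bigr => k _; rewrite preE.
(* The successive constants telescope to [b i' / b i], which is below 2. Requiring [good] only below
   [i'] lets this serve inside the strong induction, where it supplies the coefficient bound needed
   for the next vector. *)
have chain i i' m (c : nat -> K) : (forall j, (j < i')%N -> good j (nth 0 (pre j)) (v j)) ->
    (m <= i)%N -> (i <= i')%N ->
    q m (\sum_(k < i) c k *: v k) <= 2 * q m (\sum_(k < i') c k *: v k).
  move=> hg mi ii'.
  have : b i * q m (\sum_(k < i) c k *: v k) <= b i' * q m (\sum_(k < i') c k *: v k).
    elim: i' ii' hg => [|i' IH]; first by rewrite leqn0 => /eqP ->.
    rewrite leq_eqVlt => /predU1P[->//|]; rewrite ltnS => ii' hg.
    apply: le_trans (IH ii' (fun j h => hg j (leqW h))) _.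
    have [_ _ _ /(_ m c (c i') (leq_trans mi ii'))] := hg i' (ltnSn i').
    by rewrite sumE big_ord_recr.
  have := sn_ge0 (fund_sn hq m) (\sum_(k < i) c k *: v k).
  have := sn_ge0 (fund_sn hq m) (\sum_(k < i') c k *: v k).
  set x := q m _; set x' := q m _ => x0 x'0 h.
  have : 1 * x' <= b i * x' by rewrite ler_wpM2r.
  have : b i' * x <= 2 * x by rewrite ler_wpM2r// ltW.
  lra.
have vP i : good i (nth 0 (pre i)) (v i).
  elim/ltn_ind: i => i IH; apply: (nextP (i, nth 0 (pre i))) => c k ki /=.
  rewrite sumE; have q0 := fund_sn hq 0.
  have -> : nm S (c k) = q 0 (c k *: v k).
    by rewrite (snZ q0); have [_ -> _ _] := IH k ki; rewrite mulr1.
  have -> : c k *: v k = \sum_(k < k.+1) c k *: v k - \sum_(k < k) c k *: v k.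
    by rewrite big_ord_recr/= addrC addrK.
  have := snB q0 (\sum_(k < k.+1) c k *: v k) (\sum_(k < k) c k *: v k).
  have := chain k i 0%N c IH isT (ltnW ki); have := chain k.+1 i 0%N c IH isT ki; lra.
exists v; split.
- by move=> j; case: (vP j).
- by move=> j; case: (vP j).
- by move=> l j; case: (vP j) => _ _ + _; apply.
- by move=> m i i' c mi ii'; apply: chain.
Qed.

End Mazur.

(** * The real and complex fields *)

Lemma linear_exists (K : numFieldType) (V W : lmodType K) (l : V -> W) :
  (forall a x y, l (a *: x + y) = a *: l x + l y) ->
  exists phi : {linear V -> W}, forall x, phi x = l x.
Proof.
move=> h; pose M := GRing.isLinear.Build K V W *:%R l h.
by exists (HB.pack_for {linear V -> W} l M).
Qed.

Section ScalarInstances.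
Local Open Scope complex_scope.
Context (R : realType).

Lemma real_disc_net (C e : R) : 0 < e -> exists s : seq R,
  forall a, `|a| <= C -> exists2 b, b \in s & `|a - b| < e.
Proof.
move=> e0; pose N := Num.bound (2 * C / e).
exists [seq j%:R * e - C | j <- iota 0 N] => a aC.
have C0 : 0 <= C := le_trans (normr_ge0 _) aC.
have [aC1 aC2] : - C <= a /\ a <= C by apply/andP; rewrite -ler_norml.
pose j := Num.truncn ((a + C) / e).
have j0 : 0 <= (a + C) / e by rewrite divr_ge0 ?(ltW e0)//; lra.
have /andP[j1 j2] : j%:R <= (a + C) / e < j.+1%:R by rewrite truncn_itv.
exists (j%:R * e - C).
  apply/mapP; exists j => //; rewrite mem_iota add0n /= -(ltr_nat R).
  apply: le_lt_trans j1 _; apply: le_lt_trans (archi_boundP _).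
    by rewrite ler_pM2r ?invr_gt0//; lra.
  by rewrite divr_ge0 ?(ltW e0)//; lra.
rewrite ler_pdivlMr// in j1; rewrite ltr_pdivrMr// -natr1 mulrDl mul1r in j2.
rewrite ltr_norml; apply/andP; split; lra.
Qed.

Lemma real_complete (u : nat -> R) :
  (forall e : R, 0 < e -> exists N, forall m n,
    (N <= m)%N -> (N <= n)%N -> `|u m - u n| < e) ->
  exists l, forall e : R, 0 < e -> exists N, forall n, (N <= n)%N -> `|u n - l| < e.
Proof.
move=> h; have cu : cvgn u.
  apply/cauchy_cvgP/cauchy_exP => e e0; have [N hN] := h e e0.
  by exists (u N); exists N => // n Nn; exact: hN.
exists (limn u) => e e0; have /cvgrPdist_lt/(_ e e0)[N _ hN] := cu.
by exists N => n Nn; rewrite distrC; exact: hN.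
Qed.

Lemma real_scalars : inhabited (scalars R R).
Proof.
split; refine (@Scalars R R idfun (fun x => `|x|) id _ _ _ _ _ _) => //.
- by move=> a; exact: ler_norm.
- move=> V l lD lZ; apply: (@linear_exists R V R^o l) => a x y.
  by rewrite lD lZ.
- exact: real_disc_net.
- exact: real_complete.
Qed.

Lemma complex_scalars : inhabited (scalars R R[i]).
Proof.
pose nmC (z : R[i]) := Num.sqrt (complex.Re z ^+ 2 + complex.Im z ^+ 2).
have nmCE z : `|z| = (nmC z)%:C by rewrite normc_def.
have ReC z : `|complex.Re z| <= nmC z.
  by rewrite -sqrtr_sqr ler_wsqrtr// lerDl sqr_ge0.
have ImC z : `|complex.Im z| <= nmC z.
  by rewrite -sqrtr_sqr ler_wsqrtr// lerDr sqr_ge0.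
have nmle z : nmC z <= `|complex.Re z| + `|complex.Im z|.
  rewrite -[leRHS]ger0_norm ?addr_ge0// -sqrtr_sqr ler_wsqrtr//.
  rewrite sqrrD !real_normK ?num_real//.
  by rewrite -addrA addrCA [leRHS]addrC lerDl mulrn_wge0// mulr_ge0.
have ReB (a b : R[i]) : complex.Re (a - b) = complex.Re a - complex.Re b by rewrite raddfB.
have ImB (a b : R[i]) : complex.Im (a - b) = complex.Im a - complex.Im b by rewrite raddfB.
split; refine (@Scalars R R[i] (real_complex R) nmC (@complex.Re R) _ _ _ _ _ _) => //.
- exact: lecR.
- by move=> a; exact: le_trans (ler_norm _) (ReC a).
- move=> V l lD lZ.
  (* The complex form with real part [l] is [l x - i l (i x)]. *)
  have [|phi phiE] := @linear_exists R[i] V R[i]^o (fun x => l x +i* - l ('i *: x)); last first.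
    by exists phi => x; rewrite phiE.
  move=> [a b] x y.
  have E (v : V) : (a +i* b) *: v = a%:C *: v + b%:C *: ('i *: v).
    rewrite scalerA -scalerDl; congr (_ *: _); apply/eqP.
    by rewrite eq_complex/=; apply/andP; split; apply/eqP; ring.
  have E2 (v : V) : 'i *: ((a +i* b) *: v) = a%:C *: ('i *: v) - b%:C *: v.
    rewrite !scalerA -scalerBl; congr (_ *: _); apply/eqP.
    by rewrite eq_complex/=; apply/andP; split; apply/eqP; ring.
  have lN v : l (- v) = - l v.
    by rewrite -scaleN1r -(rmorph1 (real_complex R)) -rmorphN lZ mulN1r.
  rewrite scalerDr E2 E !lD lN !lZ; apply/eqP; rewrite eq_complex/=.
  by apply/andP; split; apply/eqP; ring.
- move=> C e e0; have e20 : 0 < e / 2 by rewrite divr_gt0.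
  have [s sP] := real_disc_net C e20.
  exists [seq x +i* y | x <- s, y <- s] => a aC.
  have [b1 b1s h1] := sP (complex.Re a) (le_trans (ReC a) aC).
  have [b2 b2s h2] := sP (complex.Im a) (le_trans (ImC a) aC).
  exists (b1 +i* b2); first by apply/allpairsP; exists (b1, b2).
  by apply: le_lt_trans (nmle _) _; rewrite ReB ImB/=; lra.
- move=> u hu.
  have [|x hx] := real_complete (u := fun n => complex.Re (u n)).
    move=> e e0; have [N hN] := hu e e0; exists N => m n Nm Nn.
    by rewrite -ReB; apply: le_lt_trans (ReC _) _; exact: hN.
  have [|y hy] := real_complete (u := fun n => complex.Im (u n)).
    move=> e e0; have [N hN] := hu e e0; exists N => m n Nm Nn.
    by rewrite -ImB; apply: le_lt_trans (ImC _) _; exact: hN.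
  exists (x +i* y) => e e0; have e20 : 0 < e / 2 by rewrite divr_gt0.
  have [N hN] := hx _ e20; have [N' hN'] := hy _ e20.
  exists (maxn N N') => n; rewrite geq_max => /andP[/hN h1 /hN' h2].
  by apply: le_lt_trans (nmle _) _; rewrite ReB ImB/=; lra.
Qed.

Lemma scalars_exist (K : numFieldType) : real_or_complex R K -> inhabited (scalars R K).
Proof. by case; [exact: real_scalars|exact: complex_scalars]. Qed.

End ScalarInstances.

(** * Seminorms of a Frechet space *)

Section Gauge.
Context {R : realType} {K : numFieldType} (S : scalars R K) (E : tvsType K).

Lemma convex_combination (b : set E) (s : R) x y : convex_set b -> 0 <= s -> s <= 1 ->
  b x -> b y -> b (emb S s *: x + emb S (1 - s) *: y).
Proof.
move=> cb s0 s1 bx by_.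
have es0 : 0 <= emb S s by rewrite -(rmorph0 (emb S)) emb_le.
have es1 : emb S s <= 1 by rewrite -(rmorph1 (emb S)) emb_le.
have := cb x y (Itv01 es0 es1) (mem_set bx) (mem_set by_).
by rewrite inE rmorphB rmorph1.
Qed.

(** Continuity of scaling at (0, 0) gives a disc and a neighbourhood whose product lands in [U];
    shrinking the neighbourhood by half the radius makes room for all scalars of modulus at most
    1. *)
Lemma balanced_nbhs (U : set E) : nbhs 0 U ->
  nbhs 0 [set x | forall a, nm S a <= 1 -> U (a *: x)].
Proof.
move=> U0; have := @scale_continuous K E (0, 0).
rewrite /continuous_at /= scale0r => /(_ U U0)[[A B] /= [A0 B0] AB].
move: A0; rewrite -nbhs_ballE => -[d /= d0 dA].
pose t := nm S d / 2.
have nd0 : 0 < nm S d by rewrite nm_gt0 gt_eqF.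
have t0 : 0 < t by rewrite divr_gt0.
have dE : d = emb S (nm S d) by rewrite -nmE gtr0_norm.
have td : emb S t < d by rewrite dE lt_neqAle emb_le (inj_eq (@emb_inj _ _ S)) -lt_neqAle /t; lra.
have et0 : emb S t != 0 by rewrite -(nm_gt0 S) nm_emb gtr0_norm.
apply: filterS (nbhs0Z et0 B0) => _ [y By <-] a a1; rewrite scalerA.
apply: (AB (a * emb S t, y)); split => //=; apply: dA => /=.
rewrite /ball/= sub0r normrN (nmE S) nmM nm_emb gtr0_norm//.
apply: le_lt_trans td; rewrite emb_le; nra.
Qed.

(** The seminorm is the Minkowski functional of the balanced core [V] of a convex neighbourhood
    inside [U]: passing to the core keeps convexity. *)
Lemma gauge (U : set E) : nbhs 0 U -> exists p : E -> R,
  [/\ seminorm S p, forall e, 0 < e -> nbhs 0 [set x | p x < e] &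
      forall x, p x < 1 -> U x].
Proof.
move=> U0; have [B Bconv [Bopen /(_ 0 U U0)[b [Bb b0] bU]]] := @locally_convex K E.
have cb : convex_set b := Bconv b (mem_set Bb).
have nb : nbhs 0 b by apply: open_nbhs_nbhs; split => //; exact: Bopen.
pose V : set E := [set x | forall a, nm S a <= 1 -> b (a *: x)].
have nV : nbhs 0 V := balanced_nbhs nb.
have Vb x : V x -> b x by move=> /(_ 1); rewrite nm1 scale1r; apply.
have Vbal a x : nm S a <= 1 -> V x -> V (a *: x).
  move=> a1 Vx a' a'1; rewrite scalerA; apply: Vx.
  by rewrite nmM; have := nm_ge0 S a; have := nm_ge0 S a'; nra.
have Vconv s x y : 0 <= s -> s <= 1 -> V x -> V y -> V (emb S s *: x + emb S (1 - s) *: y).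
  move=> s0 s1 Vx Vy a a1; rewrite scalerDr !scalerA ![a * _]mulrC -!scalerA.
  by apply: convex_combination => //; [exact: Vx|exact: Vy].
pose T x := [set t : R | 0 < t /\ V (emb S t^-1 *: x)].
have T0 x : T x !=set0.
  have := @scale_continuous K E (0, x); rewrite /continuous_at /= scale0r => /(_ V nV).
  move=> [[A C] /= [A0 C0] AC]; move: A0; rewrite -nbhs_ballE => -[d /= d0 dA].
  have nd0 : 0 < nm S d by rewrite nm_gt0 gt_eqF.
  have dE : d = emb S (nm S d) by rewrite -nmE gtr0_norm.
  exists (nm S d / 2)^-1; split; first by rewrite invr_gt0 divr_gt0.
  rewrite invrK; apply: (AC (emb S (nm S d / 2), x)); split => /=; last exact: nbhs_singleton.
  apply: dA; rewrite /ball/= sub0r normrN (nmE S) nm_emb gtr0_norm ?divr_gt0//.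
  by rewrite [ltRHS]dE lt_neqAle emb_le (inj_eq (@emb_inj _ _ S)) -lt_neqAle; lra.
have lbT x : lbound (T x) 0 by move=> t [/ltW].
pose p x := inf (T x).
have ple x t : T x t -> p x <= t by move=> Tt; apply: ge_inf => //; exists 0.
have p0 x : 0 <= p x by exact: lb_le_inf.
have emb0 (t : R) : 0 < t -> emb S t != 0 by move=> t0; rewrite -(nm_gt0 S) nm_emb gtr0_norm.
have pZle a x : a != 0 -> p (a *: x) <= nm S a * p x.
  move=> a0; have na0 : 0 < nm S a by rewrite nm_gt0.
  rewrite mulrC -ler_pdivrMr//; apply: lb_le_inf => // t [t0 Vt].
  rewrite ler_pdivrMr//; apply: ple; split; first exact: mulr_gt0.
  have -> : emb S (t * nm S a)^-1 *: (a *: x) = (a / emb S (nm S a)) *: (emb S t^-1 *: x).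
    by rewrite !scalerA invfM rmorphM !fmorphV; congr (_ *: _); ring.
  by apply: Vbal => //; rewrite nmM nmV nm_emb gtr0_norm// divff// gt_eqF.
have Vp x t : p x < t -> V (emb S t^-1 *: x).
  move=> xt; have [s [s0 Vs] st] : exists2 s, T x s & s < t.
    apply: contrapT => h; move: xt; rewrite ltNge => /negP; apply.
    apply: lb_le_inf => // s Ts; rewrite leNgt; apply/negP => st; apply: h.
    by exists s.
  have t0 : 0 < t := lt_trans s0 st.
  have -> : emb S t^-1 *: x = emb S (t^-1 * s) *: (emb S s^-1 *: x).
    by rewrite scalerA -rmorphM -mulrA divff ?mulr1// gt_eqF.
  apply: Vbal => //; rewrite nm_emb gtr0_norm ?mulr_gt0 ?invr_gt0//.
  by rewrite mulrC ler_pdivrMr// mul1r ltW.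
exists p; split.
- split=> // [a x|x y].
    have [->|a0] := eqVneq a 0.
      rewrite nm0 mul0r scale0r; apply/eqP; rewrite eq_le p0 andbT.
      apply/ler_addgt0Pl => e e0; rewrite addr0; apply: ple; split => //.
      by rewrite scaler0; exact: nbhs_singleton.
    apply/eqP; rewrite eq_le pZle//=.
    have := pZle a^-1 (a *: x); rewrite invr_eq0 => /(_ a0).
    by rewrite scalerA mulVf// scale1r nmV ler_pdivlMl ?nm_gt0.
  rewrite -lerBlDr; apply: lb_le_inf => // s [s0 Vs].
  rewrite lerBlDr -lerBlDl; apply: lb_le_inf => // t [t0 Vt].
  rewrite lerBlDl; apply: ple; split; first exact: addr_gt0.
  have st0 : s + t != 0 by rewrite gt_eqF// addr_gt0.
  have sl : s / (s + t) <= 1 by rewrite ler_pdivrMr ?addr_gt0//; lra.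
  have sg : 0 <= s / (s + t) by rewrite divr_ge0//; lra.
  have := Vconv _ _ _ sg sl Vs Vt; rewrite !scalerA -!rmorphM scalerDr.
  have -> : s / (s + t) * s^-1 = (s + t)^-1 by field; rewrite st0 gt_eqF.
  by have -> : (1 - s / (s + t)) * t^-1 = (s + t)^-1 by field; rewrite st0 gt_eqF.
- move=> e e0; have e20 : 0 < e / 2 by rewrite divr_gt0.
  apply: filterS (nbhs0Z (emb0 _ e20) nV) => _ [y Vy <-] /=.
  apply: (@le_lt_trans _ _ (e / 2)); last by lra.
  apply: ple; split => //; rewrite scalerA -rmorphM mulVf ?gt_eqF//.
  by rewrite rmorph1 scale1r.
- by move=> x /Vp; rewrite invr1 rmorph1 scale1r => /Vb /bU.
Qed.

End Gauge.

(** * Seminorm description of a Frechet topology *)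

Section Generates.
Context {R : realType} {K : numFieldType} (S : scalars R K).

Definition generates (E : tvsType K) (q : nat -> E -> R) :=
  forall x (U : set E), nbhs x U <->
    exists m e, 0 < e /\ forall y, q m (y - x) < e -> U y.

Lemma generates_nbhs0 (E : tvsType K) (q : nat -> E -> R) :
  (forall m e, 0 < e -> nbhs 0 [set x | q m x < e]) ->
  (forall U, nbhs 0 U -> exists m e, 0 < e /\ forall y, q m y < e -> U y) ->
  generates q.
Proof.
move=> h1 h2 x U; split.
  move=> Ux; have := nbhsB (- x) Ux; rewrite addNr => /h2[m [e [e0 h]]].
  exists m, e; split => // y /h[z Uz /eqP]; rewrite addrC => /eqP.
  by move=> /addIr <-.
move=> [m [e [e0 h]]]; apply: filterS (nbhsT x (h1 m e e0)) => _ [y qy <-].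
by apply: h; rewrite addrC addKr.
Qed.

(** The prescribed [p0] is added to partial sums of gauges of the balls of radius [1 / (n + 1)].
    Prescribing it allows a given continuous norm to head the system. *)
Lemma frechet_fundamental (E : tvsType K) (d : E -> E -> R) (p0 : E -> R) :
  frechet_metric d -> seminorm S p0 ->
  (forall e, 0 < e -> nbhs 0 [set x | p0 x < e]) ->
  exists q, [/\ fundamental S q, q 0%N = p0 & generates q].
Proof.
move=> hd p0S p0c.
have ball0 n : nbhs (0 : E) [set y | d 0 y < n.+1%:R^-1].
  by rewrite (frechet_nbhs hd); exists n.+1%:R^-1 => //=; rewrite invr_gt0 ltr0n.
have /choice[p pP] : forall n, exists p : E -> R,
  [/\ seminorm S p, forall e, 0 < e -> nbhs 0 [set x | p x < e] &
      forall x, p x < 1 -> d 0 x < n.+1%:R^-1].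
  by move=> n; exact: (gauge S (ball0 n)).
pose q n x := p0 x + \sum_(k < n) p k x.
have pge0 k x : 0 <= p k x by have [pS _ _] := pP k; exact: (sn_ge0 pS).
have qS n x : q n.+1 x = q n x + p n x by rewrite /q big_ord_recr/= addrA.
have q0 : q 0%N = p0 by apply/funext => x; rewrite /q big_ord0 addr0.
have qsn n : seminorm S (q n).
  split=> [x|a x|x y].
  - by rewrite addr_ge0 ?(sn_ge0 p0S)// sumr_ge0.
  - rewrite /q (snZ p0S) mulrDr mulr_sumr; congr (_ + _); apply: eq_bigr => k _.
    by have [pS _ _] := pP k; rewrite (snZ pS).
  - rewrite /q addrACA lerD ?(snD p0S)// -big_split/= ler_sum// => k _.
    by have [pS _ _] := pP k; rewrite (snD pS).
exists q; split => //.
  by split => // n x; rewrite qS lerDl.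
apply: generates_nbhs0.
  elim=> [|m IH] e e0; first by rewrite q0; exact: p0c.
  have e20 : 0 < e / 2 by rewrite divr_gt0.
  have [_ pc _] := pP m.
  apply: filterS (filterI (IH _ e20) (pc _ e20)) => x [/= h1 h2].
  by rewrite qS; lra.
move=> U; rewrite (frechet_nbhs hd) => -[e /= e0 eU].
pose n := Num.bound e^-1.
exists n.+1, 1; split => // x qx; apply: eU => /=.
have [_ _ pn] := pP n; apply: (@lt_trans _ _ n.+1%:R^-1).
  apply: pn; apply: le_lt_trans qx; rewrite qS lerDr.
  exact: (sn_ge0 (qsn n)).
have ei0 : 0 <= e^-1 by rewrite invr_ge0 ltW.
rewrite -[ltRHS]invrK ltf_pV2 ?posrE ?invr_gt0 ?ltr0n//.
by apply: lt_le_trans (archi_boundP ei0) _; rewrite ler_nat.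
Qed.

Lemma metric_sub (E : tvsType K) (d : E -> E -> R) x y :
  frechet_metric d -> d x y = d 0 (y - x).
Proof. by move=> hd; rewrite -(frechet_dist_translation hd x y (- x)) subrr. Qed.

Section Topology.
Context (E : tvsType K) (q : nat -> E -> R) (hq : fundamental S q) (gq : generates q).

Lemma metric_small (d : E -> E -> R) : frechet_metric d ->
  forall e, 0 < e -> exists m e', 0 < e' /\ forall x y, q m (x - y) < e' -> d x y < e.
Proof.
move=> hd e e0; have : nbhs (0 : E) [set y | d 0 y < e].
  by rewrite (frechet_nbhs hd); exists e.
move=> /gq[m [e' [e'0 h]]]; exists m, e'; split => // x y xy.
by rewrite metric_sub//; apply: h; rewrite subr0 (snC (fund_sn hq m)).
Qed.

Lemma small_metric (d : E -> E -> R) : frechet_metric d ->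
  forall m e, 0 < e -> exists e', 0 < e' /\ forall x y, d x y < e' -> q m (x - y) < e.
Proof.
move=> hd m e e0; have : nbhs (0 : E) [set y | q m y < e].
  by apply/gq; exists m, e; split => // y; rewrite subr0.
rewrite (frechet_nbhs hd) => -[e' /= e'0 h]; exists e'; split => // x y.
by rewrite (metric_sub _ _ hd) (snC (fund_sn hq m)); exact: h.
Qed.

Lemma cvg_scvg (u : nat -> E) l : u n @[n --> \oo] --> l -> scvg q u l.
Proof.
move=> ul m e e0; have : nbhs l [set y | q m (y - l) < e].
  by apply/gq; exists m, e; split.
by move=> /ul[N _ hN]; exists N => n Nn; exact: hN.
Qed.

Lemma frechet_scomplete (d : E -> E -> R) : frechet_metric d -> scomplete q.
Proof.
move=> hd u hu; have [|l ul] := frechet_complete hd (u := u); last first.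
  by exists l; exact: cvg_scvg.
move=> e e0; have [m [e' [e'0 h]]] := metric_small hd e0.
by have [N hN] := hu m e' e'0; exists N => i j Ni Nj; apply: h; exact: hN.
Qed.

Lemma closure_generates (A : set E) x : closure A x <->
  forall m e, 0 < e -> exists2 y, A y & q m (y - x) < e.
Proof.
split=> [cA m e e0|h B /gq[m [e [e0 hB]]]].
  have [|y [Ay /= hy]] := cA [set y | q m (y - x) < e]; last by exists y.
  by apply/gq; exists m, e.
by have [y Ay xy] := h m e e0; exists y; split => //; exact: hB.
Qed.

Lemma open_generates (U : set E) :
  (forall x, U x -> exists m e, 0 < e /\ forall y, q m (y - x) < e -> U y) -> open U.
Proof. by move=> h; rewrite openE => x /h xU; rewrite /interior; apply/gq. Qed.

Lemma dense_generates (A : set E) : dense A <->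
  forall x m e, 0 < e -> exists2 y, A y & q m (x - y) < e.
Proof.
split=> [dA x m e e0|h O [x Ox] oO].
  have qm := fund_sn hq m.
  have [||y [/= xy Ay]] := dA [set y | q m (y - x) < e].
  - by exists x; rewrite /= subrr (sn0 qm).
  - apply: open_generates => y /= yx; exists m, (e - q m (y - x)); split.
      by rewrite subr_gt0.
    by move=> z zy; have := sn_tri qm y z x; lra.
  - by exists y => //; rewrite (snC qm).
have /gq[m [e [e0 he]]] : nbhs x O by apply: open_nbhs_nbhs.
have [y Ay xy] := h x m e e0; exists y; split => //.
by apply: he; rewrite (snC (fund_sn hq m)).
Qed.

Lemma closed_generates (A : set E) :
  (forall x, (forall m e, 0 < e -> exists2 y, A y & q m (x - y) < e) -> A x) -> closed A.
Proof.
move=> h x /closure_generates cA; apply: h => m e e0.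
by have [y Ay yx] := cA m e e0; exists y; rewrite // (snC (fund_sn hq m)).
Qed.

(** Scaling [x] to size [e / 2] in [q m] gives the constant [2 / e]. When [q m x = 0] all multiples
    of [x] stay in the neighbourhood, which forces [p x = 0]. *)
Lemma dominated_nbhs (p : E -> R) : seminorm S p -> nbhs 0 [set x | p x < 1] ->
  dominated S q p.
Proof.
move=> hp /gq[m [e [e0 h]]]; split => //; exists m, (2 / e).
have e20 : 0 < 2 / e by rewrite divr_gt0.
split => // x; have [qx|] := ltP 0 (q m x); last first.
  move=> qx0; have {}qx0 : q m x = 0 by apply/eqP; rewrite eq_le qx0 (sn_ge0 (fund_sn hq m)).
  rewrite qx0 mulr0; apply/ler_addgt0Pl => t t0; rewrite addr0.
  have := h (emb S t^-1 *: x); rewrite subr0 (snZ (fund_sn hq m)) qx0 mulr0 => /(_ e0) /=.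
  by rewrite (snZ hp) nm_emb gtr0_norm ?invr_gt0// mulrC ltr_pdivrMr// mul1r => /ltW.
pose t := e / 2 / q m x; have t0 : 0 < t by rewrite !divr_gt0.
have := h (emb S t *: x); rewrite subr0 !(snZ (fund_sn hq m)) nm_emb gtr0_norm// /t.
rewrite divfK ?gt_eqF// => /(_ ltac:(lra)) /=.
rewrite (snZ hp) nm_emb gtr0_norm// => /ltW hx.
rewrite -(ler_pM2l t0); apply: le_trans hx _.
by rewrite le_eqVlt; apply/orP; left; apply/eqP; rewrite /t; field; rewrite !gt_eqF.
Qed.

End Topology.

Lemma generates_prod (E F : tvsType K) (q : nat -> E -> R) (r : nat -> F -> R) :
  fundamental S q -> fundamental S r -> generates q -> generates r ->
  let s n (x : (E * F)%type) := q n x.1 + r n x.2 in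
  fundamental S s /\ generates s.
Proof.
move=> hq hr gq gr s; rewrite {}/s; split.
  split=> [n|n x]; last by rewrite lerD ?hq.2 ?hr.2.
  have qn := fund_sn hq n; have rn := fund_sn hr n; split=> [x|a x|x y].
  - by rewrite addr_ge0 ?(sn_ge0 qn) ?(sn_ge0 rn).
  - by rewrite (snZ qn) (snZ rn) mulrDr.
  - by rewrite addrACA lerD ?(snD qn) ?(snD rn).
move=> [x y] U; split.
  move=> [[A B] /= [/gq[m [e [e0 hA]]] /gr[m' [e' [e'0 hB]]]] AB].
  exists (maxn m m'), (Num.min e e'); rewrite lt_min e0; split => // -[x' y'] /=.
  have qn := fund_sn hq (maxn m m'); have rn := fund_sn hr (maxn m m').
  have := sn_ge0 qn (x' - x); have := sn_ge0 rn (y' - y).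
  have := fund_le hq (x' - x) (leq_maxl m m'); have := fund_le hr (y' - y) (leq_maxr m m').
  rewrite lt_min => h1 h2 h3 h4 /andP[h5 h6]; apply: (AB (x', y')).
  by split => /=; [apply: hA; lra|apply: hB; lra].
move=> [m [e [e0 h]]]; have e20 : 0 < e / 2 by rewrite divr_gt0.
exists ([set x' | q m (x' - x) < e / 2], [set y' | r m (y' - y) < e / 2]) => /=.
  by split; [apply/gq; exists m, (e / 2)|apply/gr; exists m, (e / 2)].
by move=> [x' y'] /= [h1 h2]; apply: h => /=; lra.
Qed.

End Generates.

(** * Universality in Frechet spaces *)

Lemma lin_span_seq (K : numFieldType) (V : lmodType K) (s : seq V) x :
  lin_span [set` s] x -> exists a : 'I_(size s) -> K, x = \sum_t a t *: s`_t.
Proof.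
move=> [n [c [u [us ->]]]].
elim/big_ind: _ => [|x1 x2 [a1 ->] [a2 ->]|i _].
- by exists (fun=> 0); rewrite big1// => t _; rewrite scale0r.
- exists (fun t => a1 t + a2 t); rewrite -big_split/=.
  by apply: eq_bigr => t _; rewrite scalerDl.
- have ui : (index (u i) s < size s)%N by rewrite index_mem; exact: us.
  exists (fun t => if t == Ordinal ui then c i else 0).
  rewrite (bigD1 (Ordinal ui))//= eqxx nth_index; last exact: us.
  by rewrite big1 ?addr0// => t /negPf ->; rewrite scale0r.
Qed.

Lemma free_infinite_dimensional (K : numFieldType) (V : lmodType K) (M : set V)
    (g : nat -> V) : (forall k, M (g k)) ->
  (forall N (c : nat -> K), \sum_(k < N) c k *: g k = 0 ->
     forall k, (k < N)%N -> c k = 0) ->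
  infinite_dimensional M.
Proof.
move=> Mg gfree [B /finite_seqP[s ->] ME].
have /choice[a aP] : forall k, exists a : 'I_(size s) -> K, g k = \sum_t a t *: s`_t.
  by move=> k; apply: lin_span_seq; rewrite -ME.
have [c [j cj] cP] := kernel_vector (fun (j : 'I_(size s).+1) t => a j t).
pose c' k := if insub k is Some j then c j else 0.
have c'E (k : 'I_(size s).+1) : c' k = c k by rewrite /c' valK.
suff /gfree/(_ j (ltn_ord j)) : \sum_(k < (size s).+1) c' k *: g k = 0.
  by rewrite c'E => c0; rewrite c0 eqxx in cj.
under eq_bigr do rewrite c'E aP scaler_sumr.
rewrite exchange_big big1// => t _; under eq_bigr do rewrite scalerA.
by rewrite -scaler_suml cP scale0r.
Qed.

(** * Countable dense families *)

Section Separability.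
Context {R : realType} {K : numFieldType} (S : scalars R K).

Lemma scalar_separable : exists kappa : nat -> K,
  forall a (e : R), 0 < e -> exists i, nm S (kappa i - a) < e.
Proof.
have /choice[s sP] : forall p : nat * nat, exists s : seq K,
    forall a, nm S a <= p.1%:R -> exists2 b, b \in s & nm S (a - b) < p.2.+1%:R^-1.
  by move=> p; apply: disc_net; rewrite invr_gt0 ltr0n.
exists (fun i => if unpickle i is Some (p, l) then nth 0 (s p) l else 0).
move=> a e e0; pose p := (Num.bound (nm S a), Num.bound e^-1).
have ei0 : 0 <= e^-1 by rewrite invr_ge0 ltW.
have [b bs ab] := sP p a (ltW (archi_boundP (nm_ge0 S a))).
exists (pickle (p, index b (s p))); rewrite pickleK nth_index// -nmN opprB.
apply: lt_trans ab _; rewrite -[ltRHS]invrK ltf_pV2 ?posrE ?invr_gt0 ?ltr0n//.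
by apply: lt_le_trans (archi_boundP ei0) _; rewrite ler_nat.
Qed.

(** Separability of the target space is obtained here: once attainability makes the combinations of
    the [w n k] dense, their coefficients can be rounded to a countable set, coded together with the
    length by [pickle]. *)
Lemma separable_span (V : lmodType K) (r : nat -> V -> R) (w : nat -> nat -> V) :
  fundamental S r ->
  (forall z m (e : R), 0 < e -> exists n (c : nat -> K),
     r m (\sum_(k < n.+1) c k *: w n k - z) < e) ->
  exists zeta : nat -> V, forall z m (e : R), 0 < e -> exists l, r m (zeta l - z) < e.
Proof.
move=> hr h; have [kappa kP] := scalar_separable.
exists (fun i => if unpickle i is Some (n, t) then
   \sum_(k < n.+1) kappa (nth 0%N t k) *: w n k else 0).
move=> z m e e0; have e20 : 0 < e / 2 by rewrite divr_gt0.
have rm := fund_sn hr m; have [n [c hc]] := h z m _ e20.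
pose W := \sum_(k < n.+1) r m (w n k) + 1.
have W0 : 0 < W by rewrite ltr_pwDr// sumr_ge0// => k _; exact: (sn_ge0 rm).
have /choice[t tP] := fun k => kP (c k) _ (divr_gt0 e20 W0).
exists (pickle (n, mkseq t n.+1)); rewrite pickleK.
apply: le_lt_trans (sn_tri rm (\sum_(k < n.+1) c k *: w n k) _ _) _.
suff : r m (\sum_(k < n.+1) kappa (nth 0%N (mkseq t n.+1) k) *: w n k -
            \sum_(k < n.+1) c k *: w n k) <= e / 2 by lra.
rewrite -sumrB; apply: le_trans (sn_sum rm _ _ _) _.
apply: (@le_trans _ _ (\sum_(k < n.+1) e / 2 / W * r m (w n k))).
  apply: ler_sum => k _; rewrite -scalerBl (snZ rm) ler_wpM2r ?(sn_ge0 rm)//.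
  by rewrite nth_mkseq// ltW.
rewrite -mulr_sumr mulrAC ler_pdivrMr// ler_pM2l// /W; lra.
Qed.

End Separability.

Section Universality.
Context {R : realType} {K : numFieldType} (S : scalars R K) (E Y : tvsType K).
Context (q : nat -> E -> R) (hq : fundamental S q) (gq : generates q) (cq : scomplete q).
Context (r : nat -> Y -> R) (hr : fundamental S r) (gr : generates r).
Context (Z : set Y) (Z0 : Z 0) (Zlin : forall a x y, Z x -> Z y -> Z (a *: x + y)).
Context (f : nat -> E) (phi : nat -> {linear E -> K^o}).
Context (phif : forall k j, phi k (f j) = (j == k)%:R).
Context (f_dense : dense (lin_span (range f))).
Context (L : nat -> {linear E -> Y}).
Context (Ldom : forall n i, dominated S q (fun x => r i (L n x))).
Context (Lf : forall j, exists2 l, Z l & scvg r (fun n => L n (f j)) l).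

Definition closure_universal (L : nat -> E -> Y) : set E :=
  [set g | Z `<=` closure (range (fun n => L n g))].

Notation D := (fspan f).

Lemma closure_universalP (L' : nat -> E -> Y) g :
  closure_universal L' g <-> univ r Z L' g.
Proof.
split=> [h z m e Zz e0|h z Zz].
  have [_ [n _ <-] hn] := (closure_generates gr _ _).1 (h z Zz) m e e0.
  by exists n.
apply/(closure_generates gr) => m e e0.
by have [n hn] := h z m e Zz e0; exists (L' n g) => //; exists n.
Qed.

Lemma fspan_dense x m (e : R) : 0 < e -> exists2 h, D h & q m (x - h) < e.
Proof.
move=> e0; have [h [n [c [u [uf ->]]]] xh] := (dense_generates hq gq _).1 f_dense x m e e0.
eexists; last exact: xh.
elim/big_ind: _ => [|x1 x2 D1 D2|i _]; first exact: fspan0.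
  by rewrite -[x1]scale1r; exact: fspan_linear.
have [j _ <-] := uf i.
by rewrite -[_ *: _]addr0; apply: fspan_linear; [exact: fspan_mem|exact: fspan0].
Qed.

Lemma fspan_converges : converges_on r Z D L.
Proof.
move=> _ [N [c ->]]; elim: N => [|N [l Zl hl]].
  exists 0; rewrite ?big_ord0// => m e e0; exists 0%N => n _.
  by rewrite linear0 subr0 (sn0 (fund_sn hr m)).
have [l' Zl' hl'] := Lf N; exists (c N *: l' + l); first exact: Zlin.
move=> m e e0; have rm := fund_sn hr m; have e20 : 0 < e / 2 by rewrite divr_gt0.
have c0 : 0 < nm S (c N) + 1 by have := nm_ge0 S (c N); lra.
have [N1 hN1] := hl m _ e20; have [N2 hN2] := hl' m _ (divr_gt0 e20 c0).
exists (maxn N1 N2) => n; rewrite geq_max => /andP[/hN1 h1 /hN2 h2].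
rewrite big_ord_recr/= [X in L n X]addrC linearP opprD addrACA.
rewrite -scalerBr; apply: le_lt_trans (snD rm _ _) _; rewrite (snZ rm).
move: h2; rewrite ltr_pdivlMr// mulrDr mulr1 mulrC.
by have := sn_ge0 rm (L n (f N) - l'); lra.
Qed.

Lemma universal_attainable : closure_universal L !=set0 -> attainable q r Z L.
Proof.
move=> [g /closure_universalP ug].
apply: (univ_attainable hq hr Zlin fspan_dense fspan_converges).
by exists g.
Qed.

Context (zeta_exists : attainable q r Z L -> exists zeta : nat -> Y,
  (forall l, Z (zeta l)) /\
  forall z m (e : R), Z z -> 0 < e -> exists l, r m (zeta l - z) < e).

Lemma attainable_dense : attainable q r Z L -> dense (closure_universal L).
Proof.
move=> aL; have [zeta [Zzeta zeta_dense]] := zeta_exists aL.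
apply/(dense_generates hq gq) => x m e e0.
have [g ug xg] := univ_dense hq cq hr Z0 Zlin (fspan0 f) (@fspan_linear _ _ f) fspan_dense Ldom
  fspan_converges Zzeta zeta_dense aL x m e0.
by exists g => //; apply/closure_universalP.
Qed.

(** One open set for each pair of a target [zeta l] and an integer [m], which serves both as
    seminorm index and as precision [1 / (m + 1)]. *)
Lemma attainable_Gdelta : attainable q r Z L -> Gdelta (closure_universal L).
Proof.
move=> aL; have [zeta [Zzeta zeta_dense]] := zeta_exists aL.
pose F i : set E := if unpickle i is Some (l, m) then
  [set x | exists n, r m (L n x - zeta l) < m.+1%:R^-1] else setT.
exists F => [i|].
  rewrite /F; case: unpickle => [[l m]|]; last exact: openT.
  apply: (open_generates gq) => x [n hn]; have rm := fund_sn hr m.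
  have d0 : 0 < m.+1%:R^-1 - r m (L n x - zeta l) by rewrite subr_gt0.
  have [m' [d [d1 hd]]] := dominated_small (Ldom n m) d0.
  exists m', d; split => // y /hd hy; exists n; move: hy => /=.
  rewrite ltrBrDr; apply: le_lt_trans; rewrite linearB.
  exact: (sn_tri rm).
apply/seteqP; split=> x.
  move=> /closure_universalP ux i _; rewrite /F; case: unpickle => [[l m]|//].
  by apply: ux => //; rewrite invr_gt0 ltr0n.
move=> Fx; apply/closure_universalP => z m e Zz e0.
have e20 : 0 < e / 2 by rewrite divr_gt0.
have ei0 : 0 <= (e / 2)^-1 by rewrite invr_ge0 ltW.
pose M := maxn m (Num.bound (e / 2)^-1).
have [l hl] := zeta_dense z M _ Zz e20.
have := Fx (pickle (l, M)) I; rewrite /F pickleK => -[n hn]; exists n.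
have /(lt_trans hn) {}hn : M.+1%:R^-1 < e / 2.
  rewrite -[ltRHS]invrK ltf_pV2 ?posrE ?invr_gt0 ?ltr0n//.
  by apply: lt_le_trans (archi_boundP ei0) _; rewrite ler_nat leqW// leq_maxr.
have := fund_le hr (L n x - z) (leq_maxl m (Num.bound (e / 2)^-1)); rewrite -/M.
by have := sn_tri (fund_sn hr M) (zeta l) (L n x) z; lra.
Qed.

Lemma attainable_subsequences :
  (forall idx, increasing_index idx -> closure_universal (L \o idx) !=set0) ->
  attainable_eventually q r Z L.
Proof.
move=> h; apply: (univ_subsequences hq hr Zlin fspan_dense fspan_converges) => idx /h[g ug].
by exists g; apply/closure_universalP.
Qed.

Lemma eventually_attainable : attainable_eventually q r Z L -> attainable q r Z L.
Proof.
by move=> h z m e Zz e0; have [N hN] := h z m e Zz e0; exists N; exact: hN.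
Qed.

Lemma eventually_dense_subspace : attainable_eventually q r Z L ->
  has_dense_subspace (closure_universal L).
Proof.
move=> ev; have [zeta [Zzeta zeta_dense]] := zeta_exists (eventually_attainable ev).
have [M [M0 Mlin Mdense Muniv]] := dense_subspace hq cq hr Z0 Zlin (fspan0 f) (@fspan_linear _ _ f)
  fspan_dense Ldom fspan_converges Zzeta zeta_dense ev (fspan_mem f) (fun h Dh => Dh).
exists M; split.
- split=> [|a x y]; rewrite !inE; first exact: M0.
  exact: Mlin.
- by apply/(dense_generates hq gq) => x m e; exact: Mdense.
- by move=> x [Mx /eqP x0]; apply/closure_universalP; exact: Muniv.
Qed.

Lemma eventually_spaceable (mu : nat -> nat) (J : {linear E -> Y}) :
  (forall x, q 0 x = 0 -> x = 0) -> increasing_index mu ->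
  (forall i, dominated S q (fun x => r i (J x))) ->
  (forall n x, (forall l, (l <= mu n)%N -> phi l x = 0) -> L n x = J x) ->
  attainable_eventually q r Z L -> spaceable (closure_universal L).
Proof.
move=> q_norm mu_incr Jdom L_tail ev.
have [zeta [Zzeta zeta_dense]] := zeta_exists (eventually_attainable ev).
have [v [Dv v1 phiv vbasic]] := basic_sequence hq q_norm phif.
have Lv n j : (mu n < j)%N -> L n (v j) = J (v j).
  by move=> nj; apply: L_tail => l ln; apply: phiv; exact: leq_ltn_trans nj.
have [M [g [M0 Mlin Mclosed [Mg gfree] Muniv]]] := spaceable_subspace hq cq hr Z0 Zlin
  (fspan0 f) (@fspan_linear _ _ f) fspan_dense Ldom fspan_converges Zzeta zeta_dense
  q_norm Dv v1 vbasic
  (fun i => mu_incr _ _ (ltnSn i)) Jdom Lv ev.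
exists M; split.
- split=> [|a x y]; rewrite !inE; first exact: M0.
  exact: Mlin.
- exact: (closed_generates hq gq).
- exact: free_infinite_dimensional Mg gfree.
- by move=> x [Mx /eqP x0]; apply/closure_universalP; exact: Muniv.
Qed.

End Universality.

Lemma seminorm_comp (R : realType) (K : numFieldType) (S : scalars R K)
    (V W : lmodType K) (p : W -> R) (l : {linear V -> W}) :
  seminorm S p -> seminorm S (fun x => p (l x)).
Proof.
move=> hp; split=> [x|a x|x y]; first exact: sn_ge0 hp _.
  by rewrite linearZ (snZ hp).
by rewrite linearD (snD hp).
Qed.

Lemma continuous_combination (K : numFieldType) (T : topologicalType) (V : tvsType K)
    (c : nat -> T -> K^o) (y : nat -> V) n :
  (forall k, continuous (c k)) -> continuous (fun t => \sum_(k < n) c k t *: y k).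
Proof.
move=> hc; elim: n => [|n IH] t.
  rewrite (_ : (fun=> _) = fun=> 0) ?big_ord0; first exact: cvg_cst.
  by apply/funext => t'; rewrite big_ord0.
rewrite (_ : (fun=> _) = fun t => \sum_(k < n) c k t *: y k + c n t *: y n); last first.
  by apply/funext => t'; rewrite big_ord_recr.
have ct : c n t *: y n @[t --> t] --> c n t *: y n.
  exact: (cvg_comp2 (hc n t) (cvg_cst (y n)) (scale_continuous (_, _))).
exact: (cvg_comp2 (IH t) ct (add_continuous (_, _))).
Qed.

(** * Universal series *)

Section Series.
Context {R : realType} {K : numFieldType} (S : scalars R K).
Context {E X : tvsType K} {P : {pred (nat -> K^o)}} {A : tvsSeqType P}.
Context (f : nat -> E) (x : nat -> nat -> X) (T0 : {linear E -> A}).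
Context (std : standing_assumptions f x T0).

Lemma coord_linear k a g h :
  val (T0 (a *: g + h)) k = a * val (T0 g) k + val (T0 h) k :> K.
Proof. by rewrite !linearP. Qed.

Lemma coord_continuous k : continuous (fun g => val (T0 g) k : K^o).
Proof.
move=> g; apply: (@continuous_comp _ _ _ T0 (fun a : A => val a k : K^o)).
  exact: (T0_continuous std).
exact: (coordinate_continuous std).
Qed.

Lemma coord_f k j : val (T0 (f j)) k = (j == k)%:R :> K.
Proof. by rewrite (T0_f std) /canonical_seq eq_sym. Qed.

Lemma coord_form : exists phi : nat -> {linear E -> K^o},
  forall k g, phi k g = val (T0 g) k.
Proof.
have /choice[phi phiE] : forall k, exists phi : {linear E -> K^o},
    forall g, phi g = val (T0 g) k.
  by move=> k; apply: linear_exists => a g h; exact: coord_linear.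
by exists phi.
Qed.

Section Target.
Context (V : tvsType K) (y : nat -> nat -> V).

Lemma SX_linear n a g h :
  SX y n (T0 (a *: g + h)) = a *: SX y n (T0 g) + SX y n (T0 h).
Proof.
rewrite /SX scaler_sumr -big_split/=; apply: eq_bigr => k _.
by rewrite coord_linear scalerDl scalerA.
Qed.

Lemma SX_small (r : nat -> V -> R) n i (e : R) : fundamental S r -> generates r -> 0 < e ->
  nbhs (0 : E) [set g | r i (SX y n (T0 g)) < e].
Proof.
move=> hr gr e0.
have cont := @continuous_combination _ _ _ _ (y n) n.+1 coord_continuous 0.
apply: (cont [set v | r i v < e]); apply/gr; exists i, e; split => // v.
have -> : \sum_(k < n.+1) (val (T0 0) k : K) *: y n k = 0.
  by rewrite big1// => k _; rewrite !linear0 scale0r.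
by rewrite subr0.
Qed.

Lemma SX_f n j : (j <= n)%N -> SX y n (T0 (f j)) = y n j.
Proof.
move=> jn; rewrite /SX; have jn1 : (j < n.+1)%N by [].
rewrite (bigD1 (Ordinal jn1))//= coord_f eqxx scale1r big1 ?addr0// => k.
by rewrite -val_eqE/= coord_f eq_sym => /negPf ->; rewrite scale0r.
Qed.

Lemma SX_eq0 n g : (forall k, (k <= n)%N -> val (T0 g) k = 0 :> K) -> SX y n (T0 g) = 0.
Proof. by move=> h; rewrite /SX big1// => k _; rewrite h ?scale0r// -ltnS. Qed.

(* Replacing g by the partial sum S^F_n(T_0 g) does not change S^X_n, which turns
   condition (B)-(1)-(ii) into the general attainability condition. *)
Lemma SX_SF n g : SX y n (T0 (SF f n (T0 g))) = SX y n (T0 g).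
Proof.
apply: eq_bigr => k _; congr (_ *: _).
have [phi phiE] := coord_form; rewrite -!phiE /SF linear_sum (bigD1 k)//=.
rewrite linearZ/= [phi k (f k)]phiE coord_f eqxx /GRing.scale/= mulr1 big1 ?addr0 ?phiE// => j.
by rewrite -val_eqE/= linearZ/= phiE coord_f => /negPf ->; rewrite /GRing.scale/= mulr0.
Qed.

End Target.

(** The sums in [E] are the sums in [X] for an array constant in n, so the facts about [SX] cover
    both. *)
Lemma SFE n (a : A) : SF f n a = SX (fun=> f) n a.
Proof. by []. Qed.

Context (q : nat -> E -> R) (hq : fundamental S q) (gq : generates q) (cq : scomplete q).
Context (r : nat -> X -> R) (hr : fundamental S r) (gr : generates r).
Context (mu : nat -> nat) (mu_incr : increasing_index mu).

Let mu_ge n : (n <= mu n)%N.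
Proof. by elim: n => // n IH; apply: leq_ltn_trans IH (mu_incr (ltnSn n)). Qed.

Let sub_incr idx : increasing_index idx -> increasing_index (mu \o idx).
Proof. by move=> hidx m n /hidx /mu_incr. Qed.

Notation LX := (fun n g => SX x (mu n) (T0 g)).
Notation LB := (fun n g => (SX x (mu n) (T0 g), g - SF f (mu n) (T0 g))).
Notation rB := (fun n (y : (X * E)%type) => r n y.1 + q n y.2).
Notation ZB := ([set: X] `*` [set 0 : E]).

Lemma universalE nu : universal x T0 nu =
  closure_universal setT (fun n g => SX x (nu n) (T0 g)).
Proof.
apply/seteqP; split=> g; rewrite /universal /closure_universal /=; first by move=> <-.
by move=> h; apply/seteqP; split.
Qed.

(** Kept for an arbitrary system [q], since spaceability is applied to a system headed by the
    continuous norm and the rest to one headed by the zero seminorm. *)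
Lemma universal_cases : [/\
  universal x T0 mu !=set0 -> attainable q r setT LX,
  attainable q r setT LX -> dense (universal x T0 mu) /\ Gdelta (universal x T0 mu),
  (forall nu, increasing_index nu -> subsequence_of nu mu -> universal x T0 nu !=set0) ->
    has_dense_subspace (universal x T0 mu) &
  (forall g, q 0 g = 0 -> g = 0) ->
  (forall nu, increasing_index nu -> subsequence_of nu mu -> universal x T0 nu !=set0) ->
    spaceable (universal x T0 mu)].
Proof.
have [phi phiE] := coord_form.
have /choice[l lE] : forall n, exists l : {linear E -> X}, forall g, l g = SX x (mu n) (T0 g).
  by move=> n; apply: linear_exists; exact: SX_linear.
have -> : LX = (fun n => l n) by apply/funext => n; apply/funext => g; rewrite lE.
have UE : universal x T0 mu = closure_universal setT (fun n => l n).
  rewrite universalE; congr closure_universal.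
  by apply/funext => n; apply/funext => g; rewrite lE.
have phif k j : phi k (f j) = (j == k)%:R by rewrite phiE coord_f.
have ldom n i : dominated S q (fun g => r i (l n g)).
  apply: (dominated_nbhs hq gq); first exact: seminorm_comp (fund_sn hr i).
  by under eq_set do rewrite lE; exact: SX_small.
have lf j : exists2 y, setT y & scvg r (fun n => l n (f j)) y.
  have [y xy] := x_cvg std j; exists y => // m e e0.
  have [N hN] := cvg_scvg gr xy m e0.
  exists (maxn N j) => n; rewrite geq_max => /andP[Nn jn].
  rewrite lE SX_f ?(leq_trans jn)//; apply: hN; exact: leq_trans Nn (mu_ge n).
have zeta : attainable q r setT (fun n => l n) -> exists zeta : nat -> X,
    (forall i, setT (zeta i)) /\
    forall z m (e : R), setT z -> 0 < e -> exists i, r m (zeta i - z) < e.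
  move=> aL; have [|zeta hz] := @separable_span _ _ S _ r x hr.
    move=> z m e e0; have [n [s [_ hs]]] := aL z m e I e0.
    by exists (mu n), (fun k => val (T0 s) k); rewrite lE in hs.
  by exists zeta; split => // z m e _; exact: hz.
have Zlin (a : K) (y z : X) : setT y -> setT z -> setT (a *: y + z) by [].
have fd := span_f_dense std.
have sub : (forall nu, increasing_index nu -> subsequence_of nu mu -> universal x T0 nu !=set0) ->
    attainable_eventually q r setT (fun n => l n).
  move=> h; apply: (attainable_subsequences hq gq hr gr I Zlin fd lf) => idx hidx.
  have := h _ (sub_incr hidx) (ex_intro2 _ _ _ hidx erefl); rewrite universalE.
  have -> // : (fun n g => SX x ((mu \o idx) n) (T0 g)) = (fun n => l n) \o idx.
  by apply/funext => n; apply/funext => g; rewrite /= lE.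
rewrite UE; split.
- exact: (universal_attainable hq gq hr gr I Zlin fd lf).
- move=> aL; split.
    exact: (attainable_dense hq gq cq hr gr I Zlin fd ldom lf zeta aL).
  exact: (attainable_Gdelta gq hr gr ldom zeta aL).
- by move=> /sub; exact: (eventually_dense_subspace hq gq cq hr gr I Zlin fd ldom lf zeta).
- move=> qn /sub; have [|J J0] := @linear_exists K E X (fun=> 0).
    by move=> *; rewrite scaler0 addr0.
  apply: (eventually_spaceable hq gq cq hr gr I Zlin phif fd ldom lf zeta (J := J) qn mu_incr).
    move=> i; split; first exact: seminorm_comp (fund_sn hr i).
    exists 0%N, 1; split => // g.
    by rewrite J0 (sn0 (fund_sn hr i)) mul1r (sn_ge0 (fund_sn hq 0)).
  move=> n g h; rewrite lE J0; apply: SX_eq0 => k kn; rewrite -phiE; exact: h.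
Qed.

Lemma restricted_cases : [/\
  restricted_universal f x T0 mu !=set0 -> attainable q rB ZB LB,
  attainable q rB ZB LB -> dense (restricted_universal f x T0 mu) /\
    Gdelta (restricted_universal f x T0 mu),
  (forall nu, increasing_index nu -> subsequence_of nu mu ->
     restricted_universal f x T0 nu !=set0) ->
    has_dense_subspace (restricted_universal f x T0 mu) &
  (forall g, q 0 g = 0 -> g = 0) ->
  (forall nu, increasing_index nu -> subsequence_of nu mu ->
     restricted_universal f x T0 nu !=set0) ->
    spaceable (restricted_universal f x T0 mu)].
Proof.
have [phi phiE] := coord_form.
have [hrB grB] := generates_prod hr hq gr gq.
have /choice[l lE] : forall n, exists l : {linear E -> (X * E)%type},
    forall g, l g = (SX x (mu n) (T0 g), g - SF f (mu n) (T0 g)).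
  move=> n; apply: linear_exists => a g h.
  rewrite !SFE !SX_linear; congr pair.
  by rewrite /= scalerBr opprD addrACA.
have -> : LB = (fun n => l n) by apply/funext => n; apply/funext => g; rewrite lE.
have UE : restricted_universal f x T0 mu = closure_universal ZB (fun n => l n).
  rewrite /restricted_universal /closure_universal.
  by under [in RHS]eq_set do under eq_fun do rewrite lE.
have phif k j : phi k (f j) = (j == k)%:R by rewrite phiE coord_f.
have ldom n i : dominated S q (fun g => rB i (l n g)).
  apply: (dominated_nbhs hq gq).
    exact: (@seminorm_comp _ _ S _ _ (rB i) (l n) (fund_sn hrB i)).
  have e40 : 0 < 1 / 4 :> R by lra.
  have n1 := SX_small x (mu n) i hr gr e40.
  have n2 := SX_small (fun=> f) (mu n) i hq gq e40.
  have n3 : nbhs (0 : E) [set g | q i g < 1 / 4].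
    by apply/gq; exists i, (1 / 4); split => // g; rewrite subr0.
  apply: filterS (filterI n1 (filterI n2 n3)) => g [/= h1 [h2 h3]].
  rewrite lE /= SFE.
  by have := snB (fund_sn hq i) g (SX (fun=> f) (mu n) (T0 g)); lra.
(* From [n >= j] on, [f j] equals its partial sum, so the second component is exactly 0 and the
   limit lies in [ZB]. *)
have lf j : exists2 y, ZB y & scvg rB (fun n => l n (f j)) y.
  have [y xy] := x_cvg std j; exists (y, 0); first by split.
  move=> m e e0; have [N hN] := cvg_scvg gr xy m e0.
  exists (maxn N j) => n; rewrite geq_max => /andP[Nn jn].
  have jmu := leq_trans jn (mu_ge n).
  rewrite lE /= SFE !SX_f// !subrr (sn0 (fund_sn hq m)) addr0.
  by apply: hN; exact: leq_trans Nn (mu_ge n).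
have zeta : attainable q rB ZB (fun n => l n) -> exists zeta : nat -> (X * E)%type,
    (forall i, ZB (zeta i)) /\
    forall z m (e : R), ZB z -> 0 < e -> exists i, rB m (zeta i - z) < e.
  move=> aL; have [|zeta hz] := @separable_span _ _ S _ r x hr.
    move=> z m e e0; have [n [s [_ hs]]] := aL (z, 0) m e (conj I erefl) e0.
    exists (mu n), (fun k => val (T0 s) k); rewrite lE /= in hs.
    by apply: le_lt_trans hs; rewrite lerDl (sn_ge0 (fund_sn hq m)).
  exists (fun i => (zeta i, 0)); split => // -[z1 z2] m e [_ /= ->] e0.
  have [i hi] := hz z1 m e e0; exists i.
  by rewrite /= subrr (sn0 (fund_sn hq m)) addr0.
have Z0 : ZB 0 by split.
have Zlin (a : K) (y z : (X * E)%type) : ZB y -> ZB z -> ZB (a *: y + z).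
  by move=> [_ /= y2] [_ /= z2]; split => //=; rewrite y2 z2 scaler0 addr0.
have fd := span_f_dense std.
have sub : (forall nu, increasing_index nu -> subsequence_of nu mu ->
      restricted_universal f x T0 nu !=set0) ->
    attainable_eventually q rB ZB (fun n => l n).
  move=> h; apply: (attainable_subsequences hq gq hrB grB Z0 Zlin fd lf) => idx hidx.
  have := h _ (sub_incr hidx) (ex_intro2 _ _ _ hidx erefl).
  rewrite /restricted_universal /closure_universal.
  by under [in X in _ -> X]eq_set do under eq_fun do rewrite /= lE.
rewrite UE; split.
- exact: (universal_attainable hq gq hrB grB Z0 Zlin fd lf).
- move=> aL; split.
    exact: (attainable_dense hq gq cq hrB grB Z0 Zlin fd ldom lf zeta aL).
  exact: (attainable_Gdelta gq hrB grB ldom zeta aL).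
- by move=> /sub; exact: (eventually_dense_subspace hq gq cq hrB grB Z0 Zlin fd ldom lf zeta).
- move=> qn /sub; have [|J JE] := @linear_exists K E (X * E)%type (fun g => (0, g)).
    by move=> a g h; congr pair; rewrite /= scaler0 addr0.
  apply: (eventually_spaceable hq gq cq hrB grB Z0 Zlin phif fd ldom lf zeta (J := J) qn mu_incr).
    move=> i; split; first exact: (@seminorm_comp _ _ S _ _ (rB i) J (fund_sn hrB i)).
    exists i, 1; split => // g.
    by rewrite JE /= (sn0 (fund_sn hr i)) add0r mul1r.
  move=> n g h; have h' k : (k <= mu n)%N -> val (T0 g) k = 0 :> K by rewrite -phiE; exact: h.
  by rewrite lE JE SFE !SX_eq0// subr0.
Qed.

Context (dE : E -> E -> R) (dX : X -> X -> R) (hE : frechet_metric dE) (hX : frechet_metric dX).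

Lemma universal_attainableP : attainable q r setT LX <->
  forall y eps, 0 < eps -> exists n g, dX (SX x (mu n) (T0 g)) y < eps /\ dE g 0 < eps.
Proof.
split=> [aL y e e0|h z m e _ e0].
  have [m [d [d0 hd]]] := metric_small hq gq hE e0.
  have [m' [d' [d'0 hd']]] := metric_small hr gr hX e0.
  pose M := maxn m m'.
  have [|n [g []]] := aL y M (Num.min d d') I; first by rewrite lt_min d0.
  rewrite !lt_min => /andP[h1 _] /andP[_ h2]; exists n, g; split.
    by apply: hd'; apply: le_lt_trans h2; apply: (fund_le hr); exact: leq_maxr.
  by apply: hd; rewrite subr0; apply: le_lt_trans h1; apply: (fund_le hq); exact: leq_maxl.
have [d [d0 hd]] := small_metric hq gq hE m e0.
have [d' [d'0 hd']] := small_metric hr gr hX m e0.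
have [|n [g []]] := h z (Num.min d d'); first by rewrite lt_min d0.
rewrite !lt_min => /andP[_ h1] /andP[h2 _]; exists n, g; split; last exact: hd'.
by rewrite -[g]subr0; exact: hd.
Qed.

Lemma restricted_attainableP : attainable q rB ZB LB <->
  forall y eps, 0 < eps -> exists n g, dX (SX x (mu n) (T0 g)) y < eps /\
    dE (SF f (mu n) (T0 g)) 0 < eps.
Proof.
split=> [aL y e e0|h [z z2] m e [_ /= ->] e0].
  have [m [d [d0 hd]]] := metric_small hq gq hE e0.
  have [m' [d' [d'0 hd']]] := metric_small hr gr hX e0.
  pose M := maxn m m'; have qM := fund_sn hq M.
  have [||n [g []]] := aL (y, 0) M (Num.min (d / 2) d').
  - by split.
  - by rewrite lt_min d'0 divr_gt0.
  rewrite !lt_min /= subr0 => /andP[h1 _] /andP[h2 h3]; exists n, g; split.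
    apply: hd'; apply: le_lt_trans h3; apply: le_trans (fund_le hr _ (leq_maxr m m')) _.
    by rewrite lerDl (sn_ge0 qM).
  apply: hd; rewrite subr0; apply: le_lt_trans (fund_le hq _ (leq_maxl m m')) _.
  have := sn_sub qM (SF f (mu n) (T0 g)) g; rewrite (snC qM (SF _ _ _)).
  by have := sn_ge0 (fund_sn hr M) (SX x (mu n) (T0 g) - y); rewrite -/M; lra.
have [d [d0 hd]] := small_metric hq gq hE m e0.
have [d' [d'0 hd']] := small_metric hr gr hX m e0.
(* The witness is the partial sum of [g]: it is its own partial sum, so its second component
   vanishes, and its first is that of [g]. *)
have [|n [g []]] := h z (Num.min d d'); first by rewrite lt_min d0.
rewrite !lt_min => /andP[_ h1] /andP[h2 _]; exists n, (SF f (mu n) (T0 g)); split.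
  by rewrite -[SF _ _ _]subr0; exact: hd.
have SFSF : SF f (mu n) (T0 (SF f (mu n) (T0 g))) = SF f (mu n) (T0 g) := SX_SF (fun=> f) (mu n) g.
by rewrite /= SFSF !subrr (sn0 (fund_sn hq m)) addr0 SX_SF; exact: hd'.
Qed.

End Series.

Theorem theorem2p15 (R : realType) (K : numFieldType)
    (hK : real_or_complex R K)
    (E X : tvsType K) (P : {pred (nat -> K^o)}) (A : tvsSeqType P)
    (dE : E -> E -> R) (dX : X -> X -> R) (dA : A -> A -> R)
    (hE : frechet_metric dE) (hX : frechet_metric dX) (hA : frechet_metric dA)
    (f : nat -> E) (x : nat -> nat -> X) (T0 : {linear E -> A})
    (hstanding : standing_assumptions f x T0)
    (mu : nat -> nat) (hmu : increasing_index mu) :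
  (([<-> universal x T0 mu !=set0;
        forall (y : X) (eps : R), 0 < eps -> exists (n : nat) (g : E),
          dX (SX x (mu n) (T0 g)) y < eps /\ dE g 0 < eps;
        dense (universal x T0 mu) /\ Gdelta (universal x T0 mu)])
   /\ ((forall nu : nat -> nat, increasing_index nu -> subsequence_of nu mu ->
          universal x T0 nu !=set0) ->
       has_dense_subspace (universal x T0 mu))
   /\ (has_continuous_norm E ->
       (forall nu : nat -> nat, increasing_index nu -> subsequence_of nu mu ->
          universal x T0 nu !=set0) ->
       spaceable (universal x T0 mu)))
  /\
  (([<-> restricted_universal f x T0 mu !=set0;
        forall (y : X) (eps : R), 0 < eps -> exists (n : nat) (g : E),
          dX (SX x (mu n) (T0 g)) y < eps /\
          dE (SF f (mu n) (T0 g)) 0 < eps;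
        dense (restricted_universal f x T0 mu) /\
        Gdelta (restricted_universal f x T0 mu)])
   /\ ((forall nu : nat -> nat, increasing_index nu -> subsequence_of nu mu ->
          restricted_universal f x T0 nu !=set0) ->
       has_dense_subspace (restricted_universal f x T0 mu))
   /\ (has_continuous_norm E ->
       (forall nu : nat -> nat, increasing_index nu -> subsequence_of nu mu ->
          restricted_universal f x T0 nu !=set0) ->
       spaceable (restricted_universal f x T0 mu))).
Proof.
have [S] := scalars_exist hK.
(* The zero seminorm serves as [q 0] where no continuous norm is given. *)
have zS (V : lmodType K) : seminorm S (fun _ : V => 0 : R).
  by split=> [//|a v|v w]; rewrite ?mulr0 ?addr0.
have z0 (V : tvsType K) (e : R) : 0 < e -> nbhs (0 : V) [set v : V | 0 < e].
  by move=> e0; apply: filterS (filterT (F := nbhs (0 : V))).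
have [q [hq _ gq]] := frechet_fundamental hE (zS E) (z0 E).
have [r [hr _ gr]] := frechet_fundamental hX (zS X) (z0 X).
have cq := frechet_scomplete hq gq hE.
have dense_neq0 (U : set E) : dense U -> U !=set0.
  by move=> dU; have [||v [_ Uv]] := dU setT; [exists 0|exact: openT|exists v].
have norm_fund : has_continuous_norm E -> exists p : nat -> E -> R,
    [/\ fundamental S p, generates p, scomplete p & forall g, p 0%N g = 0 -> g = 0].
  move=> [p [p0 pd pZ pD] pc].
  (* The norm takes nonnegative values in [K]; its real-valued version is [nm S (p g)]. *)
  have pE g : p g = emb S (nm S (p g)) by rewrite -(nmE S) ger0_norm.
  have pS : seminorm S (fun g => nm S (p g)).
    split=> [g|a g|g h]; first exact: nm_ge0.
      by apply: (@emb_inj _ _ S); rewrite rmorphM -pE pZ (nmE S) -pE.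
    by rewrite -(emb_le S) rmorphD -!pE.
  have pn e : 0 < e -> nbhs (0 : E) [set g | nm S (p g) < e].
    move=> e0; have := pc 0; rewrite /continuous_at => /(_ [set a : K^o | nm S a < e]); apply.
    have -> : p 0 = 0 by rewrite -(scale0r 0) pZ normr0 mul0r.
    rewrite -nbhs_ballE; exists (emb S e) => /=.
      by rewrite lt_neqAle -(rmorph0 (emb S)) emb_le (inj_eq (@emb_inj _ _ S)) -lt_neqAle.
    move=> a; rewrite /ball/= sub0r normrN (nmE S).
    by rewrite lt_neqAle emb_le (inj_eq (@emb_inj _ _ S)) -lt_neqAle.
  have [p' [hp' p'0 gp']] := frechet_fundamental hE pS pn.
  exists p'; split => //; first exact: (frechet_scomplete hp' gp' hE).
  by move=> g; rewrite p'0 => /eqP; rewrite nm_eq0 => /eqP /pd.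
split; split.
- have [h1 h2 _ _] := universal_cases hstanding hq gq cq hr gr hmu.
  have hP := universal_attainableP x T0 hq gq hr gr mu hE hX.
  split; first by move=> /h1 /hP.
  by split; [move=> /hP /h2|move=> [/dense_neq0]].
- split=> [|/norm_fund[p [hp gp cp p0]]].
    by have [] := universal_cases hstanding hq gq cq hr gr hmu.
  by have [_ _ _] := universal_cases hstanding hp gp cp hr gr hmu; apply.
- have [h1 h2 _ _] := restricted_cases hstanding hq gq cq hr gr hmu.
  have hP := restricted_attainableP hstanding hq gq hr gr mu hE hX.
  split; first by move=> /h1 /hP.
  by split; [move=> /hP /h2|move=> [/dense_neq0]].
- split=> [|/norm_fund[p [hp gp cp p0]]].
    by have [] := restricted_cases hstanding hq gq cq hr gr hmu.
  by have [_ _ _] := restricted_cases hstanding hp gp cp hr gr hmu; apply.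
Qed.
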